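(* Let $a,b>0$. If $g\in W(L^\infty,\ell^1)$ is continuous and $(g,a,b)$ is a WH-frame, then there are $\delta>0$ and $b_0>0$ such that $(g,a',b')$ is a WH-frame for all $a'>0$ and $b'$ with $|a-a'|<\delta$ and $0<b'<b_0$.
   Context: A sequence $(f_n)_{n\in I}$ in a Hilbert space $H$ is a frame for $H$ if there are constants $A,B>0$ with $A\|f\|^2\le\sum_{n\in I}|\langle f,f_n\rangle|^2\le B\|f\|^2$ for all $f\in H$. For $g\in L^2(\mathbb R)$ (complex-valued), $a,b>0$ and $m,n\in\mathbb Z$, put $E_{mb}g(t)=e^{2\pi i mbt}g(t)$ and $T_{na}g(t)=g(t-na)$. The triple $(g,a,b)$ is called a Weyl-Heisenberg frame (WH-frame) for $L^2(\mathbb R)$ if $(E_{mb}T_{na}g)_{m,n\in\mathbb Z}$ is a frame for $L^2(\mathbb R)$. The Wiener amalgam space $W(L^\infty,\ell^1)$ is the set of $g\in L^2(\mathbb R)$ such that for some $a>0$, $\|g\|_{W,a}:=\sum_{n\in\mathbb Z}\|T_{na}g\cdot\chi_{[0,a)}\|_\infty<\infty$, where $\|\cdot\|_\infty$ is the essential supremum norm (finiteness for one $a>0$ implies finiteness for all $a>0$). *)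

(* Defs.v *)
From HB Require Import structures.
From mathcomp Require Import all_boot all_order all_algebra.
From mathcomp Require Import all_classical all_reals all_analysis.
From mathcomp Require Import complex.

Set Implicit Arguments.
Unset Strict Implicit.
Unset Printing Implicit Defensive.

Import Order.TTheory GRing.Theory Num.Theory.
Import Normc.
Import numFieldNormedType.Exports.

Local Open Scope classical_set_scope.
Local Open Scope ring_scope.
Local Open Scope complex_scope.

Section L2.
Variable R : realType.
Implicit Types (f g : R -> R[i]) (p : \bar R).

Local Notation mu := (@lebesgue_measure R).

Definition cmeasurable f : Prop :=
  measurable_fun [set: R] (fun t => complex.Re (f t)) /\
  measurable_fun [set: R] (fun t => complex.Im (f t)).

Definition cLnorm p f : \bar R := Lnorm mu p (fun t => (normc (f t))%:E).

(* Elements of L^2(R) are represented by Borel functions, not by a.e.-classes: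
   every notion below gives the same result on a.e. equal Borel functions, and
   every Lebesgue measurable function is a.e. equal to a Borel one. *)
Definition L2 : set (R -> R[i]) :=
  [set f | cmeasurable f /\ (cLnorm 2%:E f < +oo)%E].

Definition cintegral f : R[i] :=
  (\int[mu]_t complex.Re (f t))%R +i* (\int[mu]_t complex.Im (f t))%R.

Definition L2inner f g : R[i] := cintegral (fun t => f t * (g t)^*).

Definition L2frame (I : choiceType) (e : I -> R -> R[i]) : Prop :=
  (forall i, L2 (e i)) /\
  exists A B : R, [/\ 0 < A, 0 < B & forall f, L2 f ->
    ((A%:E * cLnorm 2%:E f ^+ 2 <=
        \esum_(i in [set: I]) ((normc (L2inner f (e i))) ^+ 2)%:E)%E /\
     (\esum_(i in [set: I]) ((normc (L2inner f (e i))) ^+ 2)%:E <=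
        B%:E * cLnorm 2%:E f ^+ 2)%E)].

End L2.

Section WeylHeisenberg.
Variable R : realType.
Implicit Types (g : R -> R[i]) (a b c : R).

(* e^(2 pi i c t) g(t) *)
Definition modulation c g : R -> R[i] :=
  fun t => (cos (2 * pi * c * t) +i* sin (2 * pi * c * t)) * g t.

Definition translation c g : R -> R[i] := fun t => g (t - c).

Definition WHsystem g a b (k : int * int) : R -> R[i] :=
  modulation (k.1%:~R * b) (translation (k.2%:~R * a) g).

Definition WHframe g a b : Prop := L2frame (WHsystem g a b).

Definition amalgam_norm g a : \bar R :=
  \esum_(n in [set: int])
    cLnorm +oo%E (fun t => translation (n%:~R * a) g t * \1_(`[0, a[) t).

Definition wiener_amalgam : set (R -> R[i]) :=
  [set g | L2 g /\ exists2 a : R, 0 < a & (amalgam_norm g a < +oo)%E].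

End WeylHeisenberg.

(* Main.v *)
Require Import Defs.
From HB Require Import structures.
From mathcomp Require Import all_boot all_order all_algebra.
From mathcomp Require Import all_classical all_reals all_analysis.
From mathcomp Require Import complex.
From mathcomp Require Import measurable_realfun ess_sup_inf.
From mathcomp Require Import ring lra zify.

(** Put T = 1/b. For a continuous, compactly supported f, the coefficients of f
against E_(mb) T_(na) g, m in Z, are the Fourier coefficients on [0, T] of the
T-periodization of f times the conjugate of T_(na) g, so Parseval turns the sum
of their squares into T times the integral over [0, T] of
|sum_k f(t + kT) conj(g(t + kT - na))|^2. Summed over n, the integrand is a
quadratic form in the vector (f(t + kT))_k. Its diagonal entries are the values
at t + kT of G_a(s) = sum_n |g(s - na)|^2. Its off-diagonal entries are
controlled by a Schur test [schur_near], and they are small when T is large: of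
two points at distance at least T, one is at distance at least T/2 from the
origin, where the amalgam norm leaves little of g [offdiagonal_sums]. So
(g, a, b) is a frame, with all small b allowed at once, as soon as G_a is
bounded away from 0.

That lower bound comes from the given frame. A test function supported in an
interval shorter than T leaves a single term of the periodization, and Bessel's
inequality with the lower frame bound A shows that A b is at most the supremum
of G_a near any point; as g is continuous, this bounds G_a from below
[frame_lower_bound], [uniform_lower_bound]. The tails of G_a are uniformly small on compact sets, so
on [0, 2a] the bound is already reached by a fixed finite sum; uniform
continuity of |g|^2 keeps half of it when a moves a little, and the
a'-periodicity of G_(a') carries it from [0, a'] to the line
[perturbed_lower_bound].

Test functions are enough, because they are dense in L^2 and only the
positivity of the frame bounds matters, not their values [frame_from_test].
Hence Fourier series are needed for continuous functions only. Completeness of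
the exponentials is obtained by sampling: the discrete Fejer sums of a
continuous periodic function are trigonometric polynomials close to it
[trig_approx], and comparing with the best L^2 approximation gives Parseval's
inequality [parseval_ge]. *)

Set Implicit Arguments.
Unset Strict Implicit.
Unset Printing Implicit Defensive.

Import Order.TTheory GRing.Theory Num.Theory.
Import numFieldNormedType.Exports.
Import Normc.

Local Open Scope classical_set_scope.
Local Open Scope ring_scope.
Local Open Scope complex_scope.

(** * Squared modulus and a Schur test *)

Section ComplexAlgebra.
Variable R : realType.
Implicit Types (x y z : R[i]).

(** Unlike the modulus, this is a polynomial in the real and imaginary parts, so
it is continuous, measurable and expandable without square roots. *)
Definition nsq (z : R[i]) : R := (complex.Re z) ^+ 2 + (complex.Im z) ^+ 2.

Lemma sqr_normc_nsq z : normc z ^+ 2 = nsq z.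
Proof. by case: z => u v; rewrite /nsq /= sqr_sqrtr// addr_ge0 ?sqr_ge0. Qed.

Lemma nsq_ge0 z : 0 <= nsq z.
Proof. by rewrite addr_ge0 ?sqr_ge0. Qed.

Lemma normc_ge0 z : 0 <= normc z.
Proof. by case: z => u v; exact: sqrtr_ge0. Qed.

Lemma cReD x y : complex.Re (x + y) = complex.Re x + complex.Re y.
Proof. by case: x y => [u v] [u' v']. Qed.
Lemma cImD x y : complex.Im (x + y) = complex.Im x + complex.Im y.
Proof. by case: x y => [u v] [u' v']. Qed.
Lemma cReN x : complex.Re (- x) = - complex.Re x.
Proof. by case: x. Qed.
Lemma cImN x : complex.Im (- x) = - complex.Im x.
Proof. by case: x. Qed.
Lemma cReM x y : complex.Re (x * y) =
  complex.Re x * complex.Re y - complex.Im x * complex.Im y.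
Proof. by case: x y => [u v] [u' v']. Qed.
Lemma cImM x y : complex.Im (x * y) =
  complex.Re x * complex.Im y + complex.Im x * complex.Re y.
Proof. by case: x y => [u v] [u' v']. Qed.
Lemma cReJ x : complex.Re (conjc x) = complex.Re x.
Proof. by case: x. Qed.
Lemma cImJ x : complex.Im (conjc x) = - complex.Im x.
Proof. by case: x. Qed.

Lemma cRe_sum (I : Type) (r : seq I) (P : pred I) (F : I -> R[i]) :
  complex.Re (\sum_(i <- r | P i) F i) = \sum_(i <- r | P i) complex.Re (F i).
Proof. by apply: (big_morph (@complex.Re R) (id1 := 0)) => // x y; exact: cReD. Qed.

Lemma cIm_sum (I : Type) (r : seq I) (P : pred I) (F : I -> R[i]) :
  complex.Im (\sum_(i <- r | P i) F i) = \sum_(i <- r | P i) complex.Im (F i).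
Proof. by apply: (big_morph (@complex.Im R) (id1 := 0)) => // x y; exact: cImD. Qed.

Lemma nsqM x y : nsq (x * y) = nsq x * nsq y.
Proof. by rewrite /nsq cReM cImM; ring. Qed.

Lemma nsqN x : nsq (- x) = nsq x.
Proof. by rewrite /nsq cReN cImN !sqrrN. Qed.

Lemma nsqJ x : nsq (conjc x) = nsq x.
Proof. by rewrite /nsq cReJ cImJ sqrrN. Qed.

Lemma nsq0 : nsq 0 = 0.
Proof. by rewrite /nsq /= expr0n addr0. Qed.

Lemma nsqD x y : nsq (x + y) = nsq x + nsq y + 2 * complex.Re (x * conjc y).
Proof. by rewrite /nsq cReD cImD cReM cReJ cImJ; ring. Qed.

Lemma nsqB x y : nsq (x - y) = nsq x + nsq y - 2 * complex.Re (x * conjc y).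
Proof. by rewrite /nsq cReD cImD cReM cReJ cImJ cReN cImN; ring. Qed.

Lemma nsqD_le x y : nsq (x + y) <= 2 * nsq x + 2 * nsq y.
Proof.
have := nsq_ge0 (x - y); rewrite nsqB nsqD; lra.
Qed.

Lemma nsq_real (u : R) : nsq u%:C = u ^+ 2.
Proof. by rewrite /nsq /= expr0n addr0. Qed.

Lemma nsq_sum_expand (I : finType) (F : I -> R[i]) :
  (nsq (\sum_i F i))%:C = \sum_i \sum_j F i * conjc (F j).
Proof.
rewrite -sqr_normc_nsq.
have -> z : (normc z ^+ 2)%:C = z * conjc z.
  case: z => u v; apply/eqP; rewrite eq_complex /= sqr_sqrtr ?addr_ge0 ?sqr_ge0//.
  by apply/andP; split; apply/eqP; ring.
by rewrite rmorph_sum/= mulr_suml; apply: eq_bigr => i _; rewrite mulr_sumr.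
Qed.

Lemma normc_conj x : normc (conjc x) = normc x.
Proof. by case: x => u v /=; rewrite sqrrN. Qed.

Lemma normr_Re_le x : `|complex.Re x| <= normc x.
Proof.
by case: x => u v /=; rewrite -[`|u|]sqrtr_sqr ler_wsqrtr// lerDl sqr_ge0.
Qed.

Lemma normc_le_ReIm x : normc x <= `|complex.Re x| + `|complex.Im x|.
Proof.
rewrite -ler_sqr ?nnegrE ?normc_ge0 ?addr_ge0// sqr_normc_nsq /nsq.
rewrite -(real_normK (num_real (complex.Re x))) -(real_normK (num_real (complex.Im x))).
have := normr_ge0 (complex.Re x); have := normr_ge0 (complex.Im x).
by nra.
Qed.

(** Expanding the square, the off-diagonal terms are the real parts of
F i * conj(F j). *)
Lemma nsq_sum_near (I : finType) (F : I -> R[i]) :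
  `|nsq (\sum_i F i) - \sum_i nsq (F i)| <=
    \sum_i \sum_(j | j != i) normc (F i) * normc (F j).
Proof.
have -> : nsq (\sum_i F i) - \sum_i nsq (F i) =
    \sum_i \sum_(j | j != i) complex.Re (F i * conjc (F j)).
  have := congr1 (@complex.Re R) (nsq_sum_expand F); rewrite /= => ->.
  rewrite cRe_sum -sumrB; apply: eq_bigr => i _.
  by rewrite cRe_sum (bigD1 i)//= {1}/nsq cReM cReJ cImJ; ring.
apply: (le_trans (ler_norm_sum _ _ _)); apply: ler_sum => i _.
apply: (le_trans (ler_norm_sum _ _ _)); apply: ler_sum => j _.
by apply: (le_trans (normr_Re_le _)); rewrite normcM normc_conj.
Qed.

(** In the off-diagonal terms |x_i| |x_j| is at most the mean of |x_i|^2 and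
|x_j|^2, and the weight w i j = sum_n |M n i| |M n j| is symmetric, so both
halves contribute the same row sums, which e bounds. *)
Lemma schur_near (I : finType) (J : Type) (s : seq J) (x : I -> R[i])
    (M : J -> I -> R[i]) (e : R) :
  (forall i, \sum_(j | j != i) \sum_(n <- s) normc (M n i) * normc (M n j) <= e) ->
  `|\sum_(n <- s) nsq (\sum_i x i * M n i) -
    \sum_i nsq (x i) * \sum_(n <- s) nsq (M n i)| <= e * \sum_i nsq (x i).
Proof.
move=> He.
have -> : \sum_i nsq (x i) * \sum_(n <- s) nsq (M n i) =
    \sum_(n <- s) \sum_i nsq (x i * M n i).
  rewrite exchange_big; apply: eq_bigr => i _; rewrite mulr_sumr.
  by apply: eq_bigr => n _; rewrite nsqM.
rewrite -sumrB; apply: (le_trans (ler_norm_sum _ _ _)).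
pose w i j := \sum_(n <- s) normc (M n i) * normc (M n j).
have wC i j : w i j = w j i by apply: eq_bigr => n _; rewrite mulrC.
have w_ge0 i j : 0 <= w i j by apply: sumr_ge0 => n _; rewrite mulr_ge0 ?normc_ge0.
apply: (@le_trans _ _ (\sum_i \sum_(j | j != i)
    (nsq (x i) / 2 * w i j + nsq (x j) / 2 * w i j))).
  apply: (@le_trans _ _ (\sum_(n <- s) \sum_i \sum_(j | j != i)
      normc (x i * M n i) * normc (x j * M n j))).
    by apply: ler_sum => n _; exact: nsq_sum_near.
  rewrite exchange_big; apply: ler_sum => i _.
  rewrite exchange_big; apply: ler_sum => j _.
  rewrite -mulrDl /w mulr_sumr; apply: ler_sum => n _.
  rewrite !normcM mulrACA; apply: ler_wpM2r; first by rewrite mulr_ge0 ?normc_ge0.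
  rewrite -!sqr_normc_nsq; have := sqr_ge0 (normc (x i) - normc (x j)); nra.
under eq_bigr do rewrite big_split/=.
rewrite big_split/=.
have -> : \sum_i \sum_(j | j != i) nsq (x j) / 2 * w i j =
    \sum_i \sum_(j | j != i) nsq (x i) / 2 * w i j.
  rewrite (exchange_big_dep xpredT)//=; apply: eq_bigr => i _.
  by apply: eq_big => [j|j _]; [rewrite eq_sym | rewrite wC].
rewrite -big_split/= mulr_sumr; apply: ler_sum => i _.
rewrite -!mulr_sumr -mulrDl -splitr mulrC; apply: ler_wpM2r; first exact: nsq_ge0.
exact: He.
Qed.

End ComplexAlgebra.

(** * The discrete Fejer kernel *)

Section Cis.
Variable R : realType.
Implicit Types (x y t : R) (m k l : int).

Definition cis x : R[i] := cos x +i* sin x.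

Lemma cis0 : cis 0 = 1.
Proof. by rewrite /cis cos0 sin0. Qed.

Lemma cisD x y : cis (x + y) = cis x * cis y.
Proof.
by apply/eqP; rewrite eq_complex cReM cImM /= cosD sinD; apply/andP; split; apply/eqP; ring.
Qed.

Lemma cisJ x : conjc (cis x) = cis (- x).
Proof. by rewrite /cis cosN sinN. Qed.

Lemma nsq_cis x : nsq (cis x) = 1.
Proof. by rewrite /nsq /= cos2Dsin2. Qed.

Lemma cis2pi_nat (n : nat) : cis (2 * pi * n%:R) = 1.
Proof.
rewrite /cis; have -> : 2 * pi * n%:R = 0 + pi *+ 2 *+ n :> R.
  by rewrite add0r -mulr_natr -(mulr_natr pi); ring.
rewrite (periodicn (@cosD2pi R)) (periodicn (@sinD2pi R)).
by rewrite cos0 sin0.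
Qed.

Lemma cis2pi_int m : cis (2 * pi * m%:~R) = 1.
Proof.
case: (intP m) => [|n|n]; first by rewrite mulr0 cis0.
  by rewrite -pmulrn cis2pi_nat.
rewrite mulrNz mulrN -cisJ -pmulrn cis2pi_nat.
exact: conjc1.
Qed.

(** Keeps 1 - cos bounded below away from the multiples of 2 pi. *)
Lemma cos_le_between (d x : R) : 0 <= d <= pi -> d <= x <= 2 * pi - d -> cos x <= cos d.
Proof.
move=> /andP[d0 dpi] /andP[dx xd].
wlog xpi : x dx xd / x <= pi.
  move=> H; have [|xpi] := leP x pi; first exact: H.
  have -> : cos x = cos (2 * pi - x).
    by rewrite -cosN -(cosD2pi (- x)); congr cos; ring.
  by apply: H; lra.
have := @ltr_cos R x d; rewrite !in_itv/= d0 dpi xpi (le_trans d0 dx).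
move=> /(_ isT isT).
by move=> H; rewrite leNgt H -leNgt.
Qed.

Lemma cos_lt1 x : 0 < x < 2 * pi -> cos x < 1.
Proof.
move=> /andP[x0 x2].
pose d := Num.min (Num.min x (2 * pi - x)) pi.
have pi0 := @pi_gt0 R.
have d0 : 0 < d by rewrite !lt_min x0 subr_gt0 x2 pi0.
have dpi : d <= pi by rewrite ge_min lexx orbT.
apply: (@le_lt_trans _ _ (cos d)).
  apply: cos_le_between; first by rewrite (ltW d0).
  apply/andP; split; first by rewrite !ge_min lexx.
  have : d <= 2 * pi - x by rewrite !ge_min lexx orbT.
  lra.
rewrite -(cos0 R); have := @ltr_cos R 0 d; rewrite !in_itv/= (ltW d0) dpi lexx (ltW pi0).
by move=> /(_ isT isT) ->.
Qed.

(** A geometric sum of ratio z, where z^M = 1 and z <> 1 because 0 < |m| < M. *)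
Lemma sum_cis_roots (M : nat) m : (0 < `|m| < M)%N ->
  \sum_(j < M) cis (2 * pi * m%:~R * (j%:R / M%:R)) = 0.
Proof.
move=> /andP[m0 mM].
have M0 : (0 < M)%N by apply: leq_trans mM.
wlog mpos : m m0 mM / 0 <= m.
  move=> H; have [|m_lt0] := leP 0 m; first exact: H.
  have := H (- m); rewrite abszN => /(_ m0 mM) H1.
  have /H1 : 0 <= - m by rewrite oppr_ge0 ltW.
  move/(congr1 (@conjc R)); rewrite conjc0 rmorph_sum => H2.
  rewrite -[RHS]H2; apply: eq_bigr => j _.
  rewrite -[RHS]/(conjc (cis (2 * pi * (- m)%:~R * (j%:R / M%:R)))) cisJ; congr cis; rewrite mulrNz.
  by rewrite mulrN mulNr opprK.
pose x : R := 2 * pi * m%:~R / M%:R.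
pose z := cis x.
have zj j : cis (2 * pi * m%:~R * (j%:R / M%:R)) = z ^+ j.
  elim: j => [|j IH]; first by rewrite mul0r mulr0 cis0 expr0.
  rewrite exprS -IH /z -cisD; congr cis; rewrite -natr1 /x; ring.
have MR : (0 : R) < M%:R by rewrite ltr0n.
have mR : (0 : R) < m%:~R by rewrite ltr0z lt_def mpos -absz_gt0 m0.
have mMR : m%:~R < M%:R :> R.
  by rewrite -[m]gez0_abs// -pmulrn ltr_nat.
have z1 : z != 1.
  apply/eqP => /(congr1 (@complex.Re R)) /= cx.
  suff : cos x < 1 by rewrite cx ltxx.
  apply: cos_lt1; rewrite /x; have pi0 := @pi_gt0 R.
  rewrite divr_gt0 ?mulr_gt0//= ltr_pdivrMr// ltr_pM2l// mulr_gt0//.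
under eq_bigr do rewrite zj.
have zM : z ^+ M = 1.
  by rewrite -zj divff ?gt_eqF// mulr1 cis2pi_int.
have /eqP := subrX1 z M; rewrite zM subrr eq_sym mulf_eq0 subr_eq0 (negPf z1)/=.
by move/eqP.
Qed.

Variable N : nat.
Hypothesis N0 : (0 < N)%N.

Definition dirichlet x : R[i] := \sum_(k < N) cis (2 * pi * k%:R * x).

(** The Fejer kernel, divided by the number N + 1 of sample points. With more
points than the degree, sums over the sample points pick out the constant term
exactly, as integrals over a period would. *)
Definition fejer x : R := nsq (dirichlet x) / (N%:R * N.+1%:R).

Lemma fejer_ge0 x : 0 <= fejer x.
Proof. by rewrite divr_ge0 ?nsq_ge0// mulr_ge0. Qed.

Lemma fejerE x : (fejer x)%:C =
  (N%:R * N.+1%:R)^-1 * \sum_(k < N) \sum_(l < N) cis (2 * pi * (k%:Z - l%:Z)%:~R * x).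
Proof.
rewrite /fejer mulrC rmorphM fmorphV rmorphM /= !rmorph_nat; congr (_ * _).
rewrite nsq_sum_expand; apply: eq_bigr => k _; apply: eq_bigr => l _.
cbv beta; rewrite cisJ -cisD; congr cis; rewrite intrB -!pmulrn; ring.
Qed.

(** In the expansion of [fejerE] the frequencies k - l + c have modulus at most N,
so by [sum_cis_roots] only the terms with k + c = l survive. *)
Lemma sum_fejer_cis (c : int) x : (`|c| <= 1)%N ->
  \sum_(j < N.+1) (fejer (x - j%:R / N.+1%:R))%:C * cis (2 * pi * c%:~R * (x - j%:R / N.+1%:R)) =
  (\sum_(k < N) \sum_(l < N) (k%:Z + c == l%:Z)%:R) / N%:R.
Proof.
move=> c1.
transitivity (\sum_(j < N.+1) (N%:R * N.+1%:R)^-1 * \sum_(k < N) \sum_(l < N)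
    (cis (2 * pi * (k%:Z - l%:Z)%:~R * (x - j%:R / N.+1%:R)) *
     cis (2 * pi * c%:~R * (x - j%:R / N.+1%:R)))).
  apply: eq_bigr => j _; rewrite fejerE -[LHS]mulrA; congr (_ * _).
  by rewrite mulr_suml; apply: eq_bigr => k _; rewrite mulr_suml.
rewrite -mulr_sumr exchange_big/=.
have NC : (N%:R : R[i]) != 0 by rewrite pnatr_eq0 -lt0n.
have NC1 : (N.+1%:R : R[i]) != 0 by rewrite pnatr_eq0.
rewrite [RHS]mulrC invfM -[LHS]mulrA; congr (_ * _).
rewrite mulr_sumr; apply: eq_bigr => k _.
rewrite exchange_big mulr_sumr; apply: eq_bigr => l _ /=.
apply: (mulfI NC1); rewrite mulVKf//.
pose d : int := k%:Z - l%:Z + c.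
transitivity (cis (2 * pi * d%:~R * x) *
   \sum_(j < N.+1) conjc (cis (2 * pi * d%:~R * (j%:R / N.+1%:R)))).
  rewrite mulr_sumr; apply: eq_bigr => j _; rewrite cisJ -!cisD; congr cis.
  by rewrite /d intrD; ring.
have -> : (k%:Z + c == l%:Z) = (d == 0) by rewrite -subr_eq0 /d addrAC.
have [->|d0] := eqVneq d 0.
  rewrite mulr0z mulr0 mul0r cis0 mul1r.
  under eq_bigr do rewrite mul0r cis0 conjc1.
  by rewrite sumr_const card_ord mulr1.
rewrite -rmorph_sum sum_cis_roots; last first.
  rewrite absz_gt0 d0/= ltnS.
  have := ltn_ord k; have := ltn_ord l; rewrite /d; lia.
by rewrite rmorph0 !mulr0.
Qed.

Lemma sum_fejer x : \sum_(j < N.+1) fejer (x - j%:R / N.+1%:R) = 1.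
Proof.
have NC : (N%:R : R[i]) != 0 by rewrite pnatr_eq0 -lt0n.
have := @sum_fejer_cis 0 x isT.
under [X in _ = X / _ -> _]eq_bigr => k _.
  rewrite (bigD1 k)//= addr0 eqxx big1 ?addr0; last first.
    by move=> l lk; case: eqP => // E; case/eqP: lk; apply: val_inj => /=; lia.
  over.
rewrite sumr_const card_ord divff// => /(congr1 (@complex.Re R)).
rewrite cRe_sum => H; rewrite -[RHS]H; apply: eq_bigr => j _.
by rewrite mulr0z mulr0 mul0r cis0 mulr1.
Qed.

(** N terms survive for c = 0 and N - 1 for c = 1; the difference measures how much
the kernel concentrates near the integers. *)
Lemma sum_fejer_cos x :
  \sum_(j < N.+1) fejer (x - j%:R / N.+1%:R) *
    (1 - cos (2 * pi * (x - j%:R / N.+1%:R))) = N%:R^-1.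
Proof.
have NC : (N%:R : R) != 0 by rewrite pnatr_eq0 -lt0n.
under eq_bigr do rewrite mulrBr mulr1.
rewrite sumrB sum_fejer.
have := @sum_fejer_cis 1 x isT.
move=> /(congr1 (@complex.Re R)); rewrite cRe_sum => H.
have -> : \sum_(j < N.+1) fejer (x - j%:R / N.+1%:R) * cos (2 * pi * (x - j%:R / N.+1%:R)) =
  (N%:R - 1) / N%:R.
  transitivity (complex.Re ((\sum_(k < N) \sum_(l < N) (k%:Z + 1 == l%:Z)%:R) / (N%:R : R[i]))).
    rewrite -H; apply: eq_bigr => j _.
    by rewrite cReM /= mul0r subr0 mulr1.
  have -> : \sum_(k < N) \sum_(l < N) (k%:Z + 1 == l%:Z)%:R = (N%:R - 1) :> R[i].
    have -> : (N%:R - 1 : R[i]) = N.-1%:R.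
      by rewrite -{1}(prednK N0) -natr1 addrK.
    case: (N) N0 => // n _.
    rewrite /= big_ord_recr/= [X in _ + X]big1 ?addr0; last first.
      by move=> l _; have := ltn_ord l; case: eqP => // ; lia.
    rewrite -[in RHS](card_ord n) -sumr_const; apply: eq_bigr => k _.
    rewrite (bigD1 (lift ord0 k))//= big1 ?addr0; last first.
      by move=> l lk; case: eqP => // E; case/eqP: lk; apply: val_inj => /=; rewrite /bump/=; lia.
    by case: eqP => //; rewrite /bump/=; lia.
  rewrite -(rmorph_nat (real_complex R)) -(rmorph1 (real_complex R)) -rmorphB -fmorphV -rmorphM.
  by [].
rewrite mulrBl divff// mul1r; ring.
Qed.

End Cis.

(** * Trigonometric approximation of continuous periodic functions *)

Section TrigApprox.
Variable R : realType.

(** Uniform continuity, from compactness in its covering form applied to the filter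
of radii d tending to 0. *)
Lemma continuous_segment_modulus (u : R -> R) (a b e : R) :
  continuous u -> 0 < e ->
  exists2 d : R, 0 < d & forall t s, a <= t <= b -> `|t - s| < d -> `|u t - u s| < e.
Proof.
move=> cu e0.
have /compact_near_coveringP/(_ R (0^'+) (fun d t => forall s, `|t - s| < d -> `|u t - u s| < e)) :=
  @segment_compact R a b.
have e20 : 0 < e / 2 by rewrite divr_gt0.
case.
  move=> x _; have /cvgrPdist_lt/(_ _ e20)/nbhs_ballP[r /= r0 Hr] := cu x.
  exists (ball x (r / 2), [set d | d < r / 2]) => /=.
    split; first by apply: nbhsx_ballx; rewrite divr_gt0.
    by apply: nbhs_right_lt; rewrite divr_gt0.
  case=> t d /= [xt dr] s ts.
  have xt' : `|x - t| < r / 2 by [].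
  have h1 : `|u x - u t| < e / 2.
    by apply: Hr; rewrite /ball/= (lt_trans xt')// ltr_pdivrMr// ltr_pMr// ltr1n.
  have h2 : `|u x - u s| < e / 2.
    apply: Hr; rewrite /ball/= -(subrK t x) -addrA (le_lt_trans (ler_normD _ _))//.
    by rewrite [r]splitr ltrD// (lt_trans ts).
  rewrite -(subrK (u x) (u t)) -addrA (le_lt_trans (ler_normD _ _))//.
  by rewrite [e]splitr ltrD// distrC.
move=> d /= d0 Hd.
exists (d / 2); first by rewrite divr_gt0.
move=> t s tab; apply: Hd => //=; last by rewrite divr_gt0.
by rewrite sub0r normrN gtr0_norm ?divr_gt0// ltr_pdivrMr// ltr_pMr// ltr1n.
Qed.

Lemma continuous_segment_bounded (u : R -> R) (a b : R) :
  continuous u -> exists2 B : R, 0 <= B & forall t, a <= t <= b -> `|u t| <= B.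
Proof.
move=> cu; have [ab|ba] := leP a b; last first.
  by exists 0 => // t /andP[at_ tb]; have := le_trans at_ tb; rewrite leNgt ba.
have [|c _ Hc] := @EVT_max R (fun t => `|u t|) a b ab.
  apply: continuous_subspaceT => t; apply: continuous_comp; first exact: cu.
  exact: norm_continuous.
exists `|u c| => // t tab; apply: Hc; by rewrite in_itv.
Qed.

(** The cosine sees t and s through t - s modulo T, as u does. When t - s is within
d of a multiple of T, uniform continuity applies, passing through the
identified end points if needed; otherwise 1 - cos is bounded below. *)
Lemma periodic_modulus (u : R -> R) (T e : R) : 0 < T -> continuous u -> u 0 = u T ->
  0 < e -> exists2 C : R, 0 <= C & forall t s, 0 <= t <= T -> 0 <= s <= T ->
    `|u t - u s| <= e + C * (1 - cos (2 * pi * (t / T - s / T))).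
Proof.
move=> T0 cu u0T e0; have e20 : 0 < e / 2 by rewrite divr_gt0.
have [d0 d00 Hd0] := @continuous_segment_modulus u 0 T (e / 2) cu e20.
pose d := Num.min d0 (T / 2).
have d_gt0 : 0 < d by rewrite lt_min d00 divr_gt0.
have dT : d <= T / 2 by rewrite ge_min lexx orbT.
have Hd t s : 0 <= t <= T -> `|t - s| < d -> `|u t - u s| < e / 2.
  by move=> tT ts; apply: Hd0 => //; rewrite (lt_le_trans ts)// ge_min lexx.
have [B B0 HB] := @continuous_segment_bounded u 0 T cu.
have pi0 := @pi_gt0 R.
have c_lt1 : cos (2 * pi * (d / T)) < 1.
  apply: cos_lt1; rewrite mulr_gt0 ?divr_gt0 ?mulr_gt0//= gtr_pMr ?mulr_gt0//.
  by rewrite ltr_pdivrMr// mul1r; lra.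
exists (2 * B / (1 - cos (2 * pi * (d / T)))).
  by rewrite divr_ge0 ?mulr_ge0// subr_ge0 ltW.
move=> t s.
wlog st : t s / s <= t.
  move=> H tT sT; have [st|/ltW ts] := leP s t; first exact: H.
  rewrite distrC -[cos (_ * (t / T - _))]cosN -mulrN opprB; exact: H.
move=> tT sT.
have cge x : 0 <= 1 - cos x by rewrite subr_ge0 cos_le1.
have C0 : 0 <= 2 * B / (1 - cos (2 * pi * (d / T))) * (1 - cos (2 * pi * (t / T - s / T))).
  by rewrite mulr_ge0// divr_ge0 ?mulr_ge0// subr_ge0 ltW.
have [tsd|tsd] := ltP (t - s) d.
  have : `|u t - u s| < e / 2 by apply: Hd => //; rewrite ger0_norm ?subr_ge0.
  by move: tT sT => /andP[? ?] /andP[? ?] /ltW h; rewrite (le_trans h)//; lra.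
have [tsd2|tsd2] := ltP (T - d) (t - s).
  have h1 : `|u T - u t| < e / 2.
    apply: Hd; first by rewrite lexx ltW.
    by move: tT sT => /andP[? ?] /andP[? ?]; rewrite ger0_norm; lra.
  have h2 : `|u 0 - u s| < e / 2.
    apply: Hd; first by rewrite lexx ltW.
    move: tT sT => /andP[? ?] /andP[? ?].
    rewrite sub0r normrN ger0_norm; lra.
  have : `|u t - u s| <= e.
    rewrite -(subrK (u T) (u t)) -addrA (le_trans (ler_normD _ _))//.
    by rewrite [e]splitr lerD// ?(distrC (u t)) ltW// -u0T.
  by move=> h; rewrite (le_trans h)// lerDl.
rewrite -[leLHS]add0r lerD ?(ltW e0)//.
apply: (@le_trans _ _ (2 * B)).
  rewrite (le_trans (ler_normB _ _))//.
  by have := HB _ tT; have := HB _ sT; lra.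
rewrite -mulrA ler_peMr ?mulr_ge0// ler_pdivlMl ?subr_gt0// mulr1 lerD2l lerN2.
apply: cos_le_between.
  rewrite mulr_ge0 ?divr_ge0 ?(ltW d_gt0) ?(ltW T0) ?mulr_ge0 ?(ltW pi0)//=.
  have : d / T <= 1 / 2 by rewrite ler_pdivrMr//; lra.
  by move=> h; rewrite -mulrA mulrCA ger_pMr//; lra.
rewrite -mulrBl.
have h1 : d / T <= (t - s) / T by rewrite ler_pM2r ?invr_gt0.
have h2 : (t - s) / T <= 1 - d / T.
  by rewrite -(@divff _ T) ?gt_eqF// -mulrBl ler_pM2r ?invr_gt0.
have p2 : 0 < 2 * pi :> R by rewrite mulr_gt0.
by rewrite ler_pM2l// h1/= -[X in _ <= X - _]mulr1 -mulrBr ler_pM2l.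
Qed.

(** Continuity through the real and imaginary parts, which is how integrals of
complex functions are defined. *)
Definition ccontinuous (f : R -> R[i]) :=
  continuous (fun t => complex.Re (f t)) /\ continuous (fun t => complex.Im (f t)).

Definition trigpoly (T : R) (N : nat) (c : 'I_(N.*2) -> R[i]) (t : R) : R[i] :=
  \sum_(i < N.*2) c i * cis (2 * pi * (i%:Z - N%:Z)%:~R * (t / T)).

(** The approximant is sum_j h(t_j) K(t/T - j/(N+1)) with K the discrete Fejer kernel
and t_j = jT/(N+1). Since K >= 0 has total mass 1, the error is at most the
mean of |h(t) - h(t_j)|, which [periodic_modulus] bounds by e/2 plus C times the
mean of 1 - cos, and the latter is 1/N by [sum_fejer_cos]. *)
Lemma trig_approx (h : R -> R[i]) (T e : R) : 0 < T -> ccontinuous h -> h 0 = h T ->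
  0 < e -> exists N (c : 'I_(N.*2) -> R[i]), forall t, 0 <= t <= T ->
    normc (h t - trigpoly T c t) <= e.
Proof.
move=> T0 [ch1 ch2] h0T e0.
have e40 : 0 < e / 4 by rewrite divr_gt0.
have [C1 C10 HC1] := periodic_modulus T0 ch1 (congr1 (@complex.Re R) h0T) e40.
have [C2 C20 HC2] := periodic_modulus T0 ch2 (congr1 (@complex.Im R) h0T) e40.
pose C := C1 + C2.
have HC t s : 0 <= t <= T -> 0 <= s <= T ->
    normc (h t - h s) <= e / 2 + C * (1 - cos (2 * pi * (t / T - s / T))).
  move=> tT sT; have := HC1 _ _ tT sT; have := HC2 _ _ tT sT => k2 k1.
  have : normc (h t - h s) <= `|complex.Re (h t) - complex.Re (h s)| +
                              `|complex.Im (h t) - complex.Im (h s)|.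
    by rewrite (le_trans (normc_le_ReIm _))// cReD cReN cImD cImN.
  move=> hle; rewrite (le_trans hle)// /C mulrDl.
  by apply: (le_trans (lerD k1 k2)); lra.
have C0 : 0 <= C by rewrite addr_ge0.
have [N N0 HN] : exists2 N, (0 < N)%N & C / N%:R <= e / 2.
  exists (Num.truncn (2 * C / e)).+1 => //.
  have : 2 * C / e < (Num.truncn (2 * C / e)).+1%:R by rewrite truncnS_gt.
  by rewrite ler_pdivrMr ?ltr0n// ltr_pdivrMr//; lra.
pose ts (j : nat) : R := j%:R / N.+1%:R * T.
have tsT j : (j < N.+1)%N -> 0 <= ts j <= T.
  move=> jN; rewrite /ts mulr_ge0 ?divr_ge0 ?(ltW T0)//= ger_pMl//.
  by rewrite ler_pdivrMr ?ltr0n// mul1r ler_nat ltnW.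
pose p t := \sum_(j < N.+1) h (ts j) * (fejer N (t / T - j%:R / N.+1%:R))%:C.
pose A (k l : 'I_N) := (N%:R * N.+1%:R)^-1 * \sum_(j < N.+1)
   h (ts j) * cis (2 * pi * (k%:Z - l%:Z)%:~R * (- (j%:R / N.+1%:R))).
have ixP (q : 'I_N * 'I_N) : (q.1 + N - q.2 < N.*2)%N.
  by have := ltn_ord q.1; lia.
(* Groups the pairs (k, l) by their frequency k - l, shifted by N to be an index. *)
pose ix (q : 'I_N * 'I_N) : 'I_(N.*2) := Ordinal (ixP q).
have ixE q : (ix q)%:Z - N%:Z = q.1%:Z - q.2%:Z.
  by move: (ltn_ord q.2); rewrite /ix /=; lia.
exists N, (fun i => \sum_(q | ix q == i) A q.1 q.2) => t tT.
have -> : trigpoly T (fun i => \sum_(q | ix q == i) A q.1 q.2) t = p t.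
  rewrite /trigpoly.
  under eq_bigr do rewrite mulr_suml.
  transitivity (\sum_(q : 'I_N * 'I_N)
      A q.1 q.2 * cis (2 * pi * (q.1%:Z - q.2%:Z)%:~R * (t / T))).
    rewrite [RHS](partition_big ix xpredT)//=; apply: eq_bigr => i _.
    by apply: eq_bigr => q /eqP <-; rewrite ixE.
  rewrite -(pair_bigA _ (fun k l : 'I_N => A k l * cis (2 * pi * (k%:Z - l%:Z)%:~R * (t / T))))/=.
  rewrite /p; under [RHS]eq_bigr => j _.
    rewrite fejerE// mulrCA mulr_sumr mulr_sumr.
    under eq_bigr => k _ do rewrite mulr_sumr mulr_sumr.
    over.
  rewrite [RHS]exchange_big/=; apply: eq_bigr => k _.
  rewrite [RHS]exchange_big/=; apply: eq_bigr => l _.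
  rewrite /A -mulrA mulr_suml mulr_sumr; apply: eq_bigr => j _.
  by rewrite [in RHS]mulrDr cisD; ring.
have fs1 := sum_fejer N0 (t / T).
have -> : h t - p t = \sum_(j < N.+1) (h t - h (ts j)) * (fejer N (t / T - j%:R / N.+1%:R))%:C.
  under [RHS]eq_bigr do rewrite mulrBl.
  by rewrite sumrB -mulr_sumr -rmorph_sum fs1 mulr1.
apply: (@le_trans _ _ (\sum_(j < N.+1) fejer N (t / T - j%:R / N.+1%:R) *
    (e / 2 + C * (1 - cos (2 * pi * (t / T - j%:R / N.+1%:R)))))).
  elim/big_ind2 : _ => //; first by rewrite normc0.
    by move=> x1 x2 y1 y2 H1 H2; apply: (le_trans (le_normcD _ _)); exact: lerD.
  move=> j _; rewrite normcM mulrC.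
  have -> : normc (fejer N (t / T - j%:R / N.+1%:R))%:C = fejer N (t / T - j%:R / N.+1%:R).
    by rewrite /= expr0n addr0 sqrtr_sqr ger0_norm// fejer_ge0.
  apply: ler_wpM2l; first exact: fejer_ge0.
  apply: (le_trans (HC _ _ tT (tsT _ (ltn_ord j)))).
  by rewrite /ts mulfK// gt_eqF.
under eq_bigr do rewrite mulrDr [X in _ + X]mulrCA.
rewrite big_split/= -mulr_suml fs1 mul1r -mulr_sumr sum_fejer_cos//; lra.
Qed.

End TrigApprox.

(** * Continuous complex-valued functions *)

Section ContinuousComplex.
Variable R : realType.
Implicit Types (f g : R -> R[i]) (u v : R -> R).

Local Notation mu := (@lebesgue_measure R).

Lemma continuous_mul u v : continuous u -> continuous v ->
  continuous (fun t => u t * v t).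
Proof. by move=> cu cv t; apply: cvgM; [exact: cu|exact: cv]. Qed.

Lemma continuous_add u v : continuous u -> continuous v ->
  continuous (fun t => u t + v t).
Proof. by move=> cu cv t; apply: cvgD; [exact: cu|exact: cv]. Qed.

Lemma continuous_sub u v : continuous u -> continuous v ->
  continuous (fun t => u t - v t).
Proof. by move=> cu cv t; apply: cvgB; [exact: cu|exact: cv]. Qed.

Lemma continuous_opp u : continuous u -> continuous (fun t => - u t).
Proof. by move=> cu t; apply: cvgN; exact: cu. Qed.

Lemma continuous_sum (I : Type) (r : seq I) (u : I -> R -> R) :
  (forall i, continuous (u i)) -> continuous (fun t => \sum_(i <- r) u i t).
Proof.
move=> cu; elim: r => [|i r IH].
  by under eq_fun do rewrite big_nil; move=> t; exact: cvg_cst.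
by under eq_fun do rewrite big_cons; exact: continuous_add.
Qed.

Lemma ccontinuousM f g : ccontinuous f -> ccontinuous g ->
  ccontinuous (fun t => f t * g t).
Proof.
move=> [f1 f2] [g1 g2]; split.
  under eq_fun do rewrite cReM.
  by apply: continuous_sub; apply: continuous_mul.
under eq_fun do rewrite cImM.
by apply: continuous_add; apply: continuous_mul.
Qed.

Lemma ccontinuousB f g : ccontinuous f -> ccontinuous g ->
  ccontinuous (fun t => f t - g t).
Proof.
move=> [f1 f2] [g1 g2]; split.
  under eq_fun do rewrite cReD cReN.
  exact: continuous_sub.
under eq_fun do rewrite cImD cImN.
exact: continuous_sub.
Qed.

Lemma ccontinuousJ f : ccontinuous f -> ccontinuous (fun t => conjc (f t)).
Proof.
move=> [f1 f2]; split; first by under eq_fun do rewrite cReJ.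
by under eq_fun do rewrite cImJ; exact: continuous_opp.
Qed.

Lemma ccontinuous_cst (c : R[i]) : ccontinuous (fun _ : R => c).
Proof. by split=> t; exact: cvg_cst. Qed.

Lemma ccontinuous_sum (I : Type) (r : seq I) (f : I -> R -> R[i]) :
  (forall i, ccontinuous (f i)) -> ccontinuous (fun t => \sum_(i <- r) f i t).
Proof.
move=> cf; split.
  under eq_fun do rewrite cRe_sum.
  by apply: continuous_sum => i; case: (cf i).
under eq_fun do rewrite cIm_sum.
by apply: continuous_sum => i; case: (cf i).
Qed.

Lemma ccontinuous_comp f u : ccontinuous f -> continuous u ->
  ccontinuous (fun t => f (u t)).
Proof.
move=> [f1 f2] cu; split=> t.
  by apply: (@continuous_comp _ _ _ u (fun x => complex.Re (f x))); [exact: cu|exact: f1].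
by apply: (@continuous_comp _ _ _ u (fun x => complex.Im (f x))); [exact: cu|exact: f2].
Qed.

Lemma ccontinuous_cis u : continuous u -> ccontinuous (fun t => cis (u t)).
Proof.
move=> cu; split=> t /=.
  by apply: (@continuous_comp _ _ _ u (@cos R)); [exact: cu|exact: continuous_cos].
by apply: (@continuous_comp _ _ _ u (@sin R)); [exact: cu|exact: continuous_sin].
Qed.

Lemma continuous_nsq f : ccontinuous f -> continuous (fun t => nsq (f t)).
Proof.
by move=> [f1 f2]; apply: continuous_add; apply: continuous_mul.
Qed.

Lemma continuous_linear (a : R) : continuous (fun t : R => a * t).
Proof. by move=> t; apply: cvgM; [exact: cvg_cst|exact: cvg_id]. Qed.

Lemma continuous_shift_by (a : R) : continuous (fun t : R => t + a).
Proof. by move=> t; apply: cvgD; [exact: cvg_id|exact: cvg_cst]. Qed.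

Lemma continuous_segment_integrable u (a b : R) : continuous u ->
  mu.-integrable `[a, b] (EFin \o u).
Proof.
move=> cu; apply: continuous_compact_integrable; first exact: segment_compact.
exact: continuous_subspaceT.
Qed.

End ContinuousComplex.

(** * Bessel and Parseval on one period *)

Section Parseval.
Variables (R : realType) (T : R).
Hypothesis T0 : 0 < T.
Implicit Types (f g h : R -> R[i]) (u v : R -> R).
Local Notation mu := (@lebesgue_measure R).

Definition intT u : R := \int[mu]_(t in `[0, T]) u t.
Definition cintT f : R[i] := intT (fun t => complex.Re (f t)) +i* intT (fun t => complex.Im (f t)).

Lemma intTD u v : continuous u -> continuous v ->
  intT (fun t => u t + v t) = intT u + intT v.
Proof.
by move=> cu cv; apply: RintegralD => //; exact: continuous_segment_integrable.
Qed.

Lemma intTB u v : continuous u -> continuous v ->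
  intT (fun t => u t - v t) = intT u - intT v.
Proof.
by move=> cu cv; apply: RintegralB => //; exact: continuous_segment_integrable.
Qed.

Lemma intTZ (c : R) u : continuous u -> intT (fun t => c * u t) = c * intT u.
Proof.
by move=> cu; apply: RintegralZl => //; exact: continuous_segment_integrable.
Qed.

Lemma intT_sum (I : Type) (r : seq I) (u : I -> R -> R) :
  (forall i, continuous (u i)) ->
  intT (fun t => \sum_(i <- r) u i t) = \sum_(i <- r) intT (u i).
Proof.
move=> cu; elim: r => [|i r IH].
  under eq_fun do rewrite big_nil.
  by rewrite big_nil /intT Rintegral_cst// mul0r.
under eq_fun do rewrite big_cons.
by rewrite big_cons intTD ?IH//; exact: continuous_sum.
Qed.

Lemma le_intT u v : continuous u -> continuous v ->
  (forall t, 0 <= t <= T -> u t <= v t) -> intT u <= intT v.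
Proof.
move=> cu cv uv; apply: le_Rintegral => //; try exact: continuous_segment_integrable.
Qed.

Lemma intT_cst (c : R) : intT (fun=> c) = c * T.
Proof.
have muT : lebesgue_measure (`[0, T] : set R) = T%:E.
  by rewrite lebesgue_measure_itv/= lte_fin T0 sube0.
by rewrite /intT Rintegral_cst//; congr (_ * _); exact: (congr1 fine muT).
Qed.

Lemma cintT_sum (I : Type) (r : seq I) (f : I -> R -> R[i]) :
  (forall i, ccontinuous (f i)) ->
  cintT (fun t => \sum_(i <- r) f i t) = \sum_(i <- r) cintT (f i).
Proof.
move=> cf; apply/eqP; rewrite eq_complex cRe_sum cIm_sum /=.
under [X in intT X == _]eq_fun do rewrite cRe_sum.
rewrite intT_sum; last by move=> i; case: (cf i).
rewrite eqxx/=.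
under [X in intT X == _]eq_fun do rewrite cIm_sum.
by rewrite intT_sum// => i; case: (cf i).
Qed.

Lemma cintTZ (c : R[i]) f : ccontinuous f -> cintT (fun t => c * f t) = c * cintT f.
Proof.
move=> [f1 f2]; apply/eqP; rewrite eq_complex cReM cImM /=.
have cst (x : R) : continuous (fun _ : R => x) by move=> t; exact: cvg_cst.
under [X in intT X == _]eq_fun do rewrite cReM.
rewrite intTB; try exact: continuous_mul.
rewrite !intTZ// eqxx/=.
under [X in intT X == _]eq_fun do rewrite cImM.
rewrite intTD; try exact: continuous_mul.
by rewrite !intTZ.
Qed.

Definition expi (m : int) (t : R) : R[i] := cis (2 * pi * m%:~R * (t / T)).

Lemma ccontinuous_expi m : ccontinuous (expi m).
Proof.
apply: ccontinuous_cis.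
have -> : (fun t : R => 2 * pi * m%:~R * (t / T)) = fun t => (2 * pi * m%:~R / T) * t.
  by apply/funext => t; ring.
exact: continuous_linear.
Qed.

Lemma expiB m n t : expi m t * conjc (expi n t) = expi (m - n) t.
Proof. by rewrite /expi cisJ -cisD intrB; congr cis; ring. Qed.

(** The primitives sin(kt)/k and - cos(kt)/k take the same value at 0 and T, as kT
is a multiple of 2 pi. *)
Lemma cintT_expi m : cintT (expi m) = (if m == 0 then T else 0)%:C.
Proof.
case: eqP => [->|/eqP m0].
  have -> : expi 0 = fun=> 1 by apply/funext => t; rewrite /expi mulr0z mulr0 mul0r cis0.
  by rewrite /cintT !intT_cst /= mul1r mul0r.
pose k : R := 2 * pi * m%:~R / T.
have k0 : k != 0.
  by rewrite /k !mulf_eq0 !negb_or invr_eq0 intr_eq0 m0 (gt_eqF T0) (gt_eqF (pi_gt0 R)) pnatr_eq0.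
have kT : k * T = 2 * pi * m%:~R by rewrite /k mulfVK// gt_eqF.
have c2 := cis2pi_int R m.
have co : cos (k * T) = 1 by rewrite kT; exact: (congr1 (@complex.Re R) c2).
have si : sin (k * T) = 0 by rewrite kT; exact: (congr1 (@complex.Im R) c2).
have E t : expi m t = cis (k * t) by rewrite /expi; congr cis; rewrite /k; ring.
have int0 (F f : R -> R) : continuous f -> (forall x : R, is_derive x (1 : R) F (f x)) ->
    F 0 = F T -> intT f = 0.
  move=> cf dF F0T.
  have cF : continuous F.
    by move=> x; apply: differentiable_continuous; apply/derivable1_diffP; apply: ex_derive.
  rewrite /intT /Rintegral (@continuous_FTC2 _ f F 0 T)//.
  - by rewrite F0T subee.
  - exact: continuous_subspaceT.
  - split.
    + by move=> x _; apply: ex_derive.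
    + by apply: cvg_at_right_filter; exact: cF.
    + by apply: cvg_at_left_filter; exact: cF.
  - by move=> x _; rewrite derive1E; exact: derive_val.
have dl (x : R) : is_derive x (1 : R) (fun t => k * t) k.
  by apply: is_derive_eq; rewrite /GRing.scale/= mulr1.
rewrite /cintT.
have -> : (fun t => complex.Re (expi m t)) = fun t => cos (k * t).
  by apply/funext => t; rewrite E.
have -> : (fun t => complex.Im (expi m t)) = fun t => sin (k * t).
  by apply/funext => t; rewrite E.
have ck := @continuous_linear R k.
have ccos : continuous (fun t : R => cos (k * t)).
  by move=> t; apply: (@continuous_comp _ _ _ (fun t => k * t) (@cos R)); [exact: ck|exact: continuous_cos].
have csin : continuous (fun t : R => sin (k * t)).
  by move=> t; apply: (@continuous_comp _ _ _ (fun t => k * t) (@sin R)); [exact: ck|exact: continuous_sin].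
have ds (x : R) : is_derive x (1 : R) (fun t => sin (k * t)) (cos (k * x) * k).
  exact: (@is_derive1_comp _ (@sin R) (fun t => k * t)).
have dc (x : R) : is_derive x (1 : R) (fun t => cos (k * t)) (- sin (k * x) * k).
  exact: (@is_derive1_comp _ (@cos R) (fun t => k * t)).
have dF1 (x : R) : is_derive x (1 : R) (fun t => k^-1 * sin (k * t)) (cos (k * x)).
  by apply: is_derive_eq; rewrite /GRing.scale/= mulrCA mulVf// mulr1.
have dF2 (x : R) : is_derive x (1 : R) (fun t => - (k^-1 * cos (k * t))) (sin (k * x)).
  by apply: is_derive_eq; rewrite /GRing.scale/= mulrCA mulVf// mulr1 opprK.
rewrite (int0 _ _ ccos dF1) ?mulr0 ?sin0 ?si//.
by rewrite (int0 _ _ csin dF2) ?mulr0 ?cos0 ?co.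
Qed.

Lemma intT_Re f : intT (fun t => complex.Re (f t)) = complex.Re (cintT f).
Proof. by []. Qed.

(** The source of both inequalities: c i equal to the i-th coefficient divided by T
gives Bessel, and the coefficients of an approximation of h give the reverse
inequality up to the error of that approximation. *)
Lemma bessel_identity (I : finType) (phi : I -> int) (c : I -> R[i]) h :
  injective phi -> ccontinuous h ->
  intT (fun t => nsq (h t - \sum_i c i * expi (phi i) t)) =
  intT (fun t => nsq (h t)) -
    2 * complex.Re (\sum_i conjc (c i) * cintT (fun t => h t * conjc (expi (phi i) t))) +
    T * \sum_i nsq (c i).
Proof.
move=> phi_inj ch.
have ce i : ccontinuous (fun t => c i * expi (phi i) t).
  by apply: ccontinuousM; [exact: ccontinuous_cst|exact: ccontinuous_expi].
have cp : ccontinuous (fun t => \sum_i c i * expi (phi i) t) by exact: ccontinuous_sum.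
under eq_fun do rewrite nsqB.
rewrite intTB; last 2 first.
- by apply: continuous_add; exact: continuous_nsq.
- under eq_fun do rewrite mulrC; apply: continuous_mul; last by move=> t; exact: cvg_cst.
  by have [] := ccontinuousM ch (ccontinuousJ cp).
rewrite intTD; try exact: continuous_nsq.
rewrite intTZ; last by have [] := ccontinuousM ch (ccontinuousJ cp).
rewrite addrAC; congr (_ + _); last first.
  have -> : (fun t => nsq (\sum_i c i * expi (phi i) t)) =
     fun t => complex.Re (\sum_i \sum_j (c i * conjc (c j)) * expi (phi i - phi j) t).
    apply/funext => t; rewrite -[LHS]/(complex.Re (nsq (\sum_i c i * expi (phi i) t))%:C).
    rewrite nsq_sum_expand; congr complex.Re; apply: eq_bigr => i _; apply: eq_bigr => j _.
    by rewrite rmorphM mulrACA expiB.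
  rewrite intT_Re cintT_sum; last first.
    move=> i; apply: ccontinuous_sum => j.
    by apply: ccontinuousM; [exact: ccontinuous_cst|exact: ccontinuous_expi].
  rewrite cRe_sum mulr_sumr; apply: eq_bigr => i _.
  rewrite cintT_sum; last first.
    by move=> j; apply: ccontinuousM; [exact: ccontinuous_cst|exact: ccontinuous_expi].
  rewrite (bigD1 i)//= big1 ?addr0 => [|j ji]; last first.
    rewrite cintTZ; last exact: ccontinuous_expi.
    rewrite cintT_expi subr_eq0 (inj_eq phi_inj) eq_sym (negPf ji).
    by rewrite rmorph0 mulr0.
  rewrite cintTZ; last exact: ccontinuous_expi.
  by rewrite cintT_expi subrr eqxx /nsq !cReM cReJ !cImM cImJ /=; ring.
congr (_ - _ * _); rewrite intT_Re; congr complex.Re.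
have -> : (fun t => h t * conjc (\sum_i c i * expi (phi i) t)) =
    fun t => \sum_i conjc (c i) * (h t * conjc (expi (phi i) t)).
  apply/funext => t; rewrite rmorph_sum mulr_sumr; apply: eq_bigr => i _.
  by rewrite rmorphM mulrCA.
have chc i : ccontinuous (fun t => h t * conjc (expi (phi i) t)).
  by apply: ccontinuousM => //; apply: ccontinuousJ; exact: ccontinuous_expi.
rewrite cintT_sum; last first.
  by move=> i; apply: ccontinuousM => //; exact: ccontinuous_cst.
by apply: eq_bigr => i _; rewrite cintTZ.
Qed.

Lemma bessel_ineq (I : finType) (phi : I -> int) h :
  injective phi -> ccontinuous h ->
  \sum_i nsq (cintT (fun t => h t * conjc (expi (phi i) t))) <=
  T * intT (fun t => nsq (h t)).
Proof.
move=> phi_inj ch; pose a i := cintT (fun t => h t * conjc (expi (phi i) t)).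
have := bessel_identity (fun i => (T^-1)%:C * a i) phi_inj ch.
have : 0 <= intT (fun t => nsq (h t - \sum_i (T^-1)%:C * a i * expi (phi i) t)).
  by apply: Rintegral_ge0 => t _; exact: nsq_ge0.
move=> + E; rewrite E cRe_sum -/(a _).
have -> : \sum_i complex.Re (conjc ((T^-1)%:C * a i) * a i) = T^-1 * \sum_i nsq (a i).
  rewrite mulr_sumr; apply: eq_bigr => i _.
  rewrite rmorphM -mulrA /nsq !cReM !cImM cReJ !cImJ cReJ /=; ring.
have -> : \sum_i nsq ((T^-1)%:C * a i) = T^-1 ^+ 2 * \sum_i nsq (a i).
  by rewrite mulr_sumr; apply: eq_bigr => i _; rewrite nsqM nsq_real.
rewrite -/(\sum_i nsq (a i)); set S := \sum_i nsq (a i).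
rewrite [X in _ + X](_ : _ = T^-1 * S); last first.
  by rewrite expr2 !mulrA divff ?mul1r// gt_eqF.
set H := intT _ => HS.
have : T^-1 * S <= H by lra.
by rewrite ler_pdivrMl.
Qed.

(** The trigonometric polynomial of [trig_approx] is at squared distance at most
d^2 T from h, and the Fourier partial sum of the same degree is closer still. *)
Lemma parseval_ge h e : 0 < e -> ccontinuous h -> h 0 = h T ->
  exists N : nat, T * intT (fun t => nsq (h t)) - e <=
    \sum_(i < N.*2) nsq (cintT (fun t => h t * conjc (expi (i%:Z - N%:Z) t))).
Proof.
move=> e0 ch h0T.
(* With d <= 1 the error T (d^2 T) is at most d T^2 <= e. *)
pose d := Num.min 1 (e / (T * T)).
have TT : 0 < T * T by rewrite mulr_gt0.
have d0 : 0 < d by rewrite lt_min ltr01 divr_gt0.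
have d1 : d <= 1 by rewrite ge_min lexx.
have dle : T * (d ^+ 2 * T) <= e.
  have : d <= e / (T * T) by rewrite ge_min lexx orbT.
  rewrite ler_pdivlMr// => h1; apply: le_trans h1.
  have -> : T * (d ^+ 2 * T) = d * (d * (T * T)) by ring.
  by rewrite ler_piMl// mulr_ge0// ltW.
have [N [c Hc]] := trig_approx T0 ch h0T d0.
exists N.
have phi_inj : injective (fun i : 'I_(N.*2) => i%:Z - N%:Z).
  by move=> i j /addIr [] /val_inj.
have := bessel_identity c phi_inj ch.
have : intT (fun t => nsq (h t - \sum_i c i * expi (i%:Z - N%:Z) t)) <= d ^+ 2 * T.
  rewrite -intT_cst; apply: le_intT.
  - apply: continuous_nsq; apply: ccontinuousB => //; apply: ccontinuous_sum => i.
    by apply: ccontinuousM; [exact: ccontinuous_cst|exact: ccontinuous_expi].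
  - by move=> t; exact: cvg_cst.
  - move=> t tT; rewrite -sqr_normc_nsq ler_sqr ?nnegrE ?normc_ge0 ?(ltW d0)//.
    exact: Hc.
set a := fun i : 'I_(N.*2) => cintT (fun t => h t * conjc (expi (i%:Z - N%:Z) t)).
set H := intT (fun t => nsq (h t)); move=> + E; rewrite {}E -/a => HH.
suff : T * (2 * complex.Re (\sum_i conjc (c i) * a i)) - T * (T * \sum_i nsq (c i)) <=
    \sum_i nsq (a i).
  move=> HS; have : T * (H - 2 * complex.Re (\sum_i conjc (c i) * a i) + T * \sum_i nsq (c i))
     <= T * (d ^+ 2 * T).
    by rewrite ler_pM2l//; exact: HH.
  by rewrite mulrDr mulrBr; move: HS dle; rewrite -/(\sum_i nsq (a i)); lra.
rewrite cRe_sum !mulr_sumr -sumrB; apply: ler_sum => i _.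
case: (c i) (a i) => [x y] [u v]; rewrite /nsq /=.
have := sqr_ge0 (u - T * x); have := sqr_ge0 (v - T * y); lra.
Qed.

End Parseval.

(** * Integrals over the line as integrals over one period *)

Section Periodization.
Variables (R : realType) (T : R).
Hypothesis T0 : 0 < T.
Implicit Types (u : R -> R).
Local Notation mu := (@lebesgue_measure R).

(** Translation invariance, as the change of variable t + x. *)
Lemma Rintegral_shift u (x : R) : continuous u ->
  \int[mu]_(t in `[x, x + T]) u t = intT T (fun t => u (t + x)).
Proof.
move=> cu; rewrite /intT /Rintegral; congr fine.
have dF (y : R) : is_derive y (1 : R) (fun t => t + x) (1 : R).
  by apply: is_derive_eq; rewrite addr0.
have dE : derive1 (fun t : R => t + x) = cst 1.
  by apply/funext => y; rewrite derive1E; exact: derive_val.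
have H := @integration_by_substitution_increasing R (fun t => t + x) u 0 T (ltW T0).
rewrite /= add0r [T + x]addrC in H; rewrite H.
- by apply: eq_integral => y _ /=; rewrite dE /= mulr1.
- by move=> y z _ _; rewrite ltrD2r.
- by rewrite dE => y _; exact: cvg_cst.
- by rewrite dE; exact: is_cvg_cst.
- by rewrite dE; exact: is_cvg_cst.
- split.
  + by move=> y _; apply: ex_derive.
  + by apply: cvg_at_right_filter; exact: continuous_shift_by.
  + by apply: cvg_at_left_filter; exact: continuous_shift_by.
- exact: continuous_subspaceT.
Qed.

Lemma Rintegral_periods u (c : R) (n : nat) : continuous u ->
  \int[mu]_(t in `[c, c + n%:R * T]) u t =
  intT T (fun t => \sum_(k < n) u (t + (c + k%:R * T))).
Proof.
move=> cu.
have cs (x : R) : continuous (fun t => u (t + x)).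
  by move=> t; apply: (@continuous_comp _ _ _ (fun t => t + x) u);
    [exact: continuous_shift_by | exact: cu].
elim: n => [|n IH].
  rewrite mul0r addr0 set_itv1 Rintegral_set1.
  under eq_fun do rewrite big_ord0.
  by rewrite intT_cst// mul0r.
under [in RHS]eq_fun do rewrite big_ord_recr.
rewrite intTD//; last exact: continuous_sum.
rewrite -IH -Rintegral_shift//.
have H := @Rintegral_itvB R u (BLeft c) (BRight (c + n.+1%:R * T)) (c + n%:R * T).
have nT : 0 <= n%:R * T by rewrite mulr_ge0// ltW.
have En : c + n.+1%:R * T = c + n%:R * T + T by rewrite -natr1 mulrDl mul1r addrA.
have := H _ _ _; rewrite bnd_simp lerDl nT bnd_simp En lerDl (ltW T0).
move=> /(_ (continuous_segment_integrable _ _ cu) isT isT).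
rewrite Rintegral_itv_obnd_cbnd; last first.
  apply: integrableS (continuous_segment_integrable (c + n%:R * T) (c + n%:R * T + T) cu) => //.
  by apply: subset_itvr; rewrite bnd_simp.
by move=> <-; rewrite addrCA subrr addr0.
Qed.

Lemma Rintegral_compact_support u (D : set R) : measurable D ->
  (forall t, ~ D t -> u t = 0) ->
  \int[mu]_t u t = \int[mu]_(t in D) u t.
Proof.
move=> mD u0; rewrite [RHS]Rintegral_mkcond; apply: eq_Rintegral => t _.
rewrite patchE; case: ifPn => // tD; apply: u0 => Dt.
by move/negP: tD; apply; rewrite inE.
Qed.

Lemma integrable_compact_support u (L : R) : continuous u ->
  (forall t, L < `|t| -> u t = 0) -> mu.-integrable setT (EFin \o u).
Proof.
move=> cu u0.
have -> : EFin \o u = (EFin \o u) \_ (`[- L, L] : set R).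
  apply/funext => t; rewrite patchE; case: ifPn => //= tD; congr EFin; apply: u0.
  rewrite ltNge; apply/negP => tL; move/negP: tD; apply.
  by rewrite inE /= in_itv/= -ler_norml.
apply/integrable_restrict => //; rewrite ?setTI//.
exact: continuous_segment_integrable.
Qed.

Lemma Rintegral_periodize u (L : R) (K : nat) : continuous u ->
  (forall t, L < `|t| -> u t = 0) -> L <= K%:R * T ->
  \int[mu]_t u t = intT T (fun t => \sum_(k < K.*2) u (t + (k%:R - K%:R) * T)).
Proof.
move=> cu u0 LK.
rewrite (@Rintegral_compact_support u `[- (K%:R * T), - (K%:R * T) + K.*2%:R * T])//.
  rewrite Rintegral_periods//; congr intT; apply/funext => t; apply: eq_bigr => k _.
  by congr u; ring.
move=> t; rewrite /= in_itv/= => /negP tD; apply: u0; rewrite ltNge; apply/negP => tL.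
move/negP: tD; apply.
have -> : - (K%:R * T) + K.*2%:R * T = K%:R * T by rewrite -addnn natrD; ring.
by rewrite -ler_norml (le_trans tL).
Qed.

End Periodization.

(** * Finite boxes of integers *)

Section IntegerBoxes.

Lemma le_sum_uniq_sub (R : realType) (I : eqType) (s1 s2 : seq I) (F : I -> R) :
  uniq s1 -> uniq s2 -> {subset s1 <= s2} -> (forall i, 0 <= F i) ->
  \sum_(i <- s1) F i <= \sum_(i <- s2) F i.
Proof.
move=> u1 u2 s12 F0.
have -> : \sum_(i <- s1) F i = \sum_(i <- s2 | i \in s1) F i.
  rewrite -[RHS]big_filter; apply: perm_big; rewrite perm_sym.
  apply: uniq_perm => //; first exact: filter_uniq.
  by move=> i; rewrite mem_filter; apply/andP/idP => [[]//|/[dup] /s12].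
by rewrite [leRHS](bigID (mem s1))/= lerDl sumr_ge0.
Qed.

(** The boxes |m| <= N exhaust Z; sums over them stand for the infinite sums over
the two indices of the system. *)
Definition zbox (N : nat) : seq int := [seq i%:Z - N%:Z | i <- iota 0 N.*2.+1].

Lemma zbox_uniq N : uniq (zbox N).
Proof. by rewrite map_inj_uniq ?iota_uniq// => i j /addIr; case. Qed.

Lemma mem_zbox N m : (m \in zbox N) = (`|m| <= N)%N.
Proof.
apply/mapP/idP => [[k] | mN].
  by rewrite mem_iota => /andP[_ kN] ->; lia.
by exists `|(m + N%:Z)%R|%N; [rewrite mem_iota; lia|lia].
Qed.

Lemma le_zbox_sum (R : realType) (F : int -> R) N N' : (N <= N')%N ->
  (forall i, 0 <= F i) -> \sum_(m <- zbox N) F m <= \sum_(m <- zbox N') F m.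
Proof.
move=> NN F0; apply: le_sum_uniq_sub => //; try exact: zbox_uniq.
by move=> m; rewrite !mem_zbox => /leq_trans; exact.
Qed.

Lemma zbox_sumE (R : realType) (F : int -> R) N :
  \sum_(m <- zbox N) F m = \sum_(i < N.*2.+1) F (i%:Z - N%:Z).
Proof.
rewrite /zbox big_map -(big_mkord xpredT (fun i => F (i%:Z - N%:Z))).
by rewrite /index_iota subn0.
Qed.

End IntegerBoxes.

(** * Coefficients of compactly supported continuous functions *)

Section TestFunctions.
Variables (R : realType) (T : R).
Hypothesis T0 : 0 < T.
Variables (g f : R -> R[i]) (a L : R) (K : nat).
Hypotheses (cg : ccontinuous g) (cf : ccontinuous f)
  (f0 : forall t, L < `|t| -> f t = 0) (LK : L < K%:R * T).
Local Notation mu := (@lebesgue_measure R).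

(** The squared L^2 norm as a real number, see [cLnorm2_L2nsq]. *)
Definition L2nsq (h : R -> R[i]) : R := \int[mu]_t nsq (h t).

(** The point t + (k - K) T: for k < 2K and t in [0, T] these points cover
[- KT, KT], hence the support of f. *)
Definition tau (k : nat) (t : R) : R := t + (k%:R - K%:R) * T.

Definition periodize (n : int) (t : R) : R[i] :=
  \sum_(k < K.*2) f (tau k t) * conjc (g (tau k t - n%:~R * a)).

Lemma L2nsq_periodize : L2nsq f = intT T (fun t => \sum_(k < K.*2) nsq (f (tau k t))).
Proof.
rewrite /L2nsq (@Rintegral_periodize R T T0 _ L K)//.
- exact: continuous_nsq.
- by move=> t tL; rewrite f0// nsq0.
- exact: ltW.
Qed.

Lemma expi_tau m k t : expi T m (tau k t) = expi T m t.
Proof.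
rewrite /expi /tau.
have -> : (t + (k%:R - K%:R) * T) / T = t / T + (k%:R - K%:R).
  by rewrite mulrDl mulfK// gt_eqF.
rewrite mulrDr cisD.
have -> : 2 * pi * m%:~R * (k%:R - K%:R) = 2 * pi * (m * (k%:Z - K%:Z))%:~R :> R.
  by rewrite intrM intrB -!pmulrn mulrA.
by rewrite cis2pi_int mulr1.
Qed.

Lemma ccontinuous_periodize n : ccontinuous (periodize n).
Proof.
have ct k : continuous (tau k) by exact: continuous_shift_by.
apply: ccontinuous_sum => k; apply: ccontinuousM.
  by apply: ccontinuous_comp.
apply: ccontinuousJ; apply: (@ccontinuous_comp _ g (fun t => tau k t - n%:~R * a)) => //.
by move=> t; apply: cvgB; [exact: ct|exact: cvg_cst].
Qed.

(** Shifting by T renumbers the terms, up to the two extreme ones, which vanish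
because f does at - KT and KT. *)
Lemma periodize_periodic n : periodize n 0 = periodize n T.
Proof.
have KT0 : f (K%:R * T) = 0 by apply: f0; exact: lt_le_trans LK (ler_norm _).
have KT0' : f (- (K%:R * T)) = 0.
  by apply: f0; rewrite normrN; exact: lt_le_trans LK (ler_norm _).
rewrite /periodize; case: (posnP K) => [K0|K0]; first by rewrite K0 !big_ord0.
pose u t (k : nat) := f (tau k t) * conjc (g (tau k t - n%:~R * a)).
rewrite -!(big_mkord xpredT (u _)).
have EK : K.*2 = K.*2.-1.+1 by lia.
rewrite EK big_nat_recl// big_nat_recr//=.
have -> : u 0 0%N = 0.
  by rewrite /u (_ : tau 0 0 = - (K%:R * T)) ?KT0' ?mul0r// /tau; ring.
have -> : u T K.*2.-1 = 0.
  rewrite /u (_ : tau K.*2.-1 T = K%:R * T) ?KT0 ?mul0r// /tau.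
  have h : K%:R + K%:R = K.*2.-1%:R + 1 :> R by rewrite natr1 -EK -natrD addnn.
  have -> : (K.*2.-1%:R : R) = K%:R + K%:R - 1 by lra.
  by ring.
rewrite add0r addr0; apply: eq_bigr => k _.
have -> : u 0 k.+1 = u T k by rewrite /u (_ : tau k.+1 0 = tau k T)// /tau -natr1; ring.
by [].
Qed.

(** The exponential has period T, so it factors out of the periodization. *)
Lemma WH_coeff b m n : b = T^-1 ->
  L2inner f (WHsystem g a b (m, n)) = cintT T (fun t => periodize n t * conjc (expi T m t)).
Proof.
move=> bT.
pose F t := f t * conjc (expi T m t * g (t - n%:~R * a)).
have cF : ccontinuous F.
  apply: ccontinuousM => //; apply: ccontinuousJ; apply: ccontinuousM.
    exact: ccontinuous_expi.
  apply: (@ccontinuous_comp _ g (fun t => t - n%:~R * a)) => //.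
  exact: continuous_shift_by.
have F0 t : L < `|t| -> F t = 0 by move=> tL; rewrite /F f0// mul0r.
have -> : L2inner f (WHsystem g a b (m, n)) = cintegral F.
  rewrite /L2inner; congr cintegral; apply/funext => t.
  rewrite /F /WHsystem /modulation /translation /=; congr (_ * conjc (_ * _)).
  by rewrite /expi /cis bT; congr (cos _ +i* sin _); ring.
have E : (fun t => \sum_(k < K.*2) F (tau k t)) = fun t => periodize n t * conjc (expi T m t).
  apply/funext => t; rewrite /periodize mulr_suml; apply: eq_bigr => k _.
  by rewrite /F expi_tau rmorphM -mulrA; congr (_ * _); rewrite mulrC.
rewrite /cintegral (@Rintegral_periodize R T T0 _ L K _ _ (ltW LK)); last 2 first.
- by case: cF.
- by move=> t tL; rewrite F0.
rewrite (@Rintegral_periodize R T T0 (fun t => complex.Im (F t)) L K _ _ (ltW LK)); last 2 first.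
- by case: cF.
- by move=> t tL; rewrite F0.
rewrite -E /cintT; congr (intT T _ +i* intT T _); apply/funext => t.
  by rewrite cRe_sum.
by rewrite cIm_sum.
Qed.

Lemma continuous_nsq_tau k : continuous (fun t => nsq (f (tau k t))).
Proof.
by apply: continuous_nsq; apply: ccontinuous_comp => //; exact: continuous_shift_by.
Qed.

(** Bessel for each n, then integration of the pointwise bound. The pointwise bound
is a statement on finite matrices for each t. *)
Lemma test_upper b (J : seq int) (D : R) N : b = T^-1 ->
  (forall t, 0 <= t <= T ->
    \sum_(n <- J) nsq (periodize n t) <= D * \sum_(k < K.*2) nsq (f (tau k t))) ->
  \sum_(n <- J) \sum_(m <- zbox N) nsq (L2inner f (WHsystem g a b (m, n))) <=
    T * (D * L2nsq f).
Proof.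
move=> bT HJ; apply: (@le_trans _ _ (\sum_(n <- J) T * intT T (fun t => nsq (periodize n t)))).
  apply: ler_sum => n _; rewrite zbox_sumE.
  under eq_bigr do rewrite WH_coeff//.
  apply: (@bessel_ineq _ _ T0 _ (fun i : 'I_N.*2.+1 => i%:Z - N%:Z)).
    by move=> i j /addIr [] /val_inj.
  exact: ccontinuous_periodize.
have cper n : continuous (fun t => nsq (periodize n t)).
  by apply: continuous_nsq; exact: ccontinuous_periodize.
rewrite -mulr_sumr ler_pM2l// -intT_sum// L2nsq_periodize -intTZ; last first.
  by apply: continuous_sum => k; exact: continuous_nsq_tau.
apply: le_intT => //; first exact: continuous_sum.
apply: continuous_mul; first by move=> t; exact: cvg_cst.
by apply: continuous_sum => k; exact: continuous_nsq_tau.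
Qed.

(** Parseval for each n. The box of frequencies depends on n, so the finitely many
boxes are replaced by the largest. *)
Lemma test_lower b (J : seq int) (c e : R) : b = T^-1 -> 0 < e ->
  (forall t, 0 <= t <= T ->
    c * \sum_(k < K.*2) nsq (f (tau k t)) <= \sum_(n <- J) nsq (periodize n t)) ->
  exists N, T * (c * L2nsq f) - e <=
    \sum_(n <- J) \sum_(m <- zbox N) nsq (L2inner f (WHsystem g a b (m, n))).
Proof.
move=> bT e0 HJ.
have cper n : continuous (fun t => nsq (periodize n t)).
  by apply: continuous_nsq; exact: ccontinuous_periodize.
suff [N HN] : exists N, T * (\sum_(n <- J) intT T (fun t => nsq (periodize n t))) - e <=
    \sum_(n <- J) \sum_(m <- zbox N) nsq (L2inner f (WHsystem g a b (m, n))).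
  exists N; apply: le_trans HN; rewrite lerD2r ler_pM2l// -intT_sum//.
  rewrite L2nsq_periodize -intTZ; last first.
    by apply: continuous_sum => k; exact: continuous_nsq_tau.
  apply: le_intT => //; last exact: continuous_sum.
  apply: continuous_mul; first by move=> t; exact: cvg_cst.
  by apply: continuous_sum => k; exact: continuous_nsq_tau.
elim: J e e0 {HJ} => [|n J IH] e e0.
  by exists 0%N; rewrite !big_nil mulr0 sub0r oppr_le0 ltW.
have e20 : 0 < e / 2 by rewrite divr_gt0.
have [N1 H1] := IH _ e20.
have [N2 H2] := parseval_ge T0 e20 (ccontinuous_periodize n) (periodize_periodic n).
exists (maxn N1 N2); rewrite big_cons [leRHS]big_cons mulrDr.
have {H1} : T * (\sum_(n <- J) intT T (fun t => nsq (periodize n t))) - e / 2 <=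
    \sum_(n <- J) \sum_(m <- zbox (maxn N1 N2)) nsq (L2inner f (WHsystem g a b (m, n))).
  apply: (le_trans H1); apply: ler_sum => k _; apply: le_zbox_sum; first exact: leq_maxl.
  by move=> m; exact: nsq_ge0.
have : T * intT T (fun t => nsq (periodize n t)) - e / 2 <=
    \sum_(m <- zbox (maxn N1 N2)) nsq (L2inner f (WHsystem g a b (m, n))).
  apply: (le_trans H2); apply: (@le_trans _ _ (\sum_(m <- zbox N2)
      nsq (L2inner f (WHsystem g a b (m, n))))); last first.
    by apply: le_zbox_sum; [exact: leq_maxr | move=> m; exact: nsq_ge0].
  rewrite zbox_sumE big_ord_recr /= -[leLHS]addr0 lerD ?nsq_ge0//.
  by apply: ler_sum => i _; rewrite WH_coeff.
move=> h1 h2; apply: le_trans (lerD h1 h2).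
by rewrite addrACA -opprD -splitr.
Qed.

End TestFunctions.

(** * Unordered sums and finite sums *)

Section FiniteSums.
Variables (R : realType) (I : choiceType).
Implicit Types (F : I -> \bar R).

Lemma seq_sum_le_esum F (J : seq I) : uniq J ->
  (\sum_(j <- J) F j <= \esum_(i in [set: I]) F i)%E.
Proof.
move=> uJ; apply: ereal_sup_ubound; exists [set` J]; last by rewrite [RHS]fsbig_seq.
by split=> //; exact: finite_seq.
Qed.

Lemma lt_esum_seq F (x : \bar R) : (x < \esum_(i in [set: I]) F i)%E ->
  exists2 J : seq I, uniq J & (x < \sum_(j <- J) F j)%E.
Proof.
move=> /ereal_sup_gt[_ [X [finX _] <-] xX].
by rewrite fsbig_finite//= in xX; exists (finmap.enum_fset (fset_set X)); [exact: finmap.fset_uniq|].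
Qed.

End FiniteSums.

(** * Sums of g along arithmetic progressions *)

Section Amalgam.
Variable R : realType.
Implicit Types (g : R -> R[i]).
Local Notation mu := (@lebesgue_measure R).

Lemma continuous_ccontinuous g : continuous (g : R -> R[i]^o) -> ccontinuous g.
Proof.
move=> cg; split=> t; apply/cvgrPdist_lt => e e0.
  have e0' : 0 < e%:C :> R[i] by rewrite ltcR.
  have /cvgrPdist_lt/(_ _ e0') := cg t.
  apply: filterS => s; rewrite normc_def ltcR => H; apply: le_lt_trans H.
  by rewrite -cReN -cReD -[leLHS]sqrtr_sqr ler_wsqrtr// lerDl sqr_ge0.
have e0' : 0 < e%:C :> R[i] by rewrite ltcR.
have /cvgrPdist_lt/(_ _ e0') := cg t.
apply: filterS => s; rewrite normc_def ltcR => H; apply: le_lt_trans H.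
by rewrite -cImN -cImD -[leLHS]sqrtr_sqr ler_wsqrtr// lerDr sqr_ge0.
Qed.

Lemma continuous_normc g : ccontinuous g -> continuous (fun t => normc (g t)).
Proof.
move=> cg t; have -> : (fun t => normc (g t)) = (fun t => Num.sqrt (nsq (g t))).
  by apply/funext => s; rewrite -sqr_normc_nsq sqrtr_sqr ger0_norm// normc_ge0.
apply: (@continuous_comp _ _ _ (fun t => nsq (g t)) (@Num.sqrt R)).
  exact: continuous_nsq.
exact: sqrt_continuous.
Qed.

Lemma lebesgue_measureT_gt0 : (0 < lebesgue_measure [set: R])%E.
Proof.
have := @lebesgue_measure_itv R `]-oo, +oo[%R; rewrite set_itvNyy /= => ->.
by rewrite addye.
Qed.

(** A value at t above the essential supremum would persist, by continuity, on an
interval to the right of t, which has positive measure. *)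
Lemma cLnorm_infty_ge g (a0 c t : R) : ccontinuous g -> 0 <= t < a0 ->
  ((normc (g (t - c)))%:E <=
    cLnorm +oo (fun t => (translation c g t * \1_(`[0, a0[) t)%R))%E.
Proof.
move=> cg /andP[t0 ta].
set h := fun t => translation c g t * \1_(`[0, a0[) t.
have -> : cLnorm +oo%E h = ess_sup lebesgue_measure (abse \o (fun t => (normc (h t))%:E)).
  rewrite /cLnorm unlock /=.
  by have -> : (0 < lebesgue_measure [set: R])%E by exact: lebesgue_measureT_gt0.
rewrite leNgt; apply/negP => Vlt.
set V := ess_sup _ _ in Vlt.
have V0 : (0 <= V)%E.
  apply: ess_sup_gee; first exact: lebesgue_measureT_gt0.
  by apply: nearW => x /=; rewrite lee_fin.
have VE : V = (fine V)%:E by rewrite fineK// ge0_fin_numE// (lt_trans Vlt)// ltry.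
have cn : continuous (fun s => normc (g (s - c))).
  move=> s; apply: (@continuous_comp _ _ _ (fun s => s - c) (fun s => normc (g s))).
    exact: continuous_shift_by.
  exact: continuous_normc.
have Vlt' : fine V < normc (g (t - c)) by rewrite -lte_fin -VE.
have := @cvgr_gt _ _ _ (nbhs_filter t) _ _ (cn t) _ Vlt'.
move=> /nbhs_ballP[r /= r0 Hr].
pose r' := Num.min r (a0 - t).
have r'0 : 0 < r' by rewrite lt_min r0 subr_gt0.
have [N [mN N0 HN]] := @ess_sup_ge _ _ R lebesgue_measure (abse \o (fun t => (normc (h t))%:E)).
have sub : `]t, (t + r')[ `<=` N.
  move=> s /=; rewrite in_itv/= => /andP[ts sr].
  apply: HN => /= hV.
  have sa : s < a0 by rewrite (lt_le_trans sr)// -lerBrDl ge_min lexx orbT.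
  have : fine V < normc (g (s - c)).
    apply: Hr; rewrite /ball/= distrC ger0_norm ?subr_ge0 ?(ltW ts)//.
    by rewrite ltrBlDl (lt_le_trans sr)// lerD2l ge_min lexx.
  apply/negP; rewrite -leNgt -lee_fin -VE; apply: le_trans hV.
  rewrite /h /translation indicE mem_set ?mulr1//= ?in_itv/= ?(le_trans t0 (ltW ts))//.
  by rewrite lee_fin ler_norm.
have : (lebesgue_measure ([set` `]t, t + r'[%R] : set R) <= 0)%E.
  by rewrite -N0; apply: le_measure => //; rewrite inE//.
rewrite lebesgue_measure_itv/= lte_fin ltrDl r'0 -EFinB lee_fin.
by rewrite addrAC subrr add0r leNgt r'0.
Qed.

(** beta j is the essential supremum of |g| over [- j a0, - j a0 + a0). The last
clause says that the tails of the amalgam series are small. *)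
Lemma amalgam_majorant g : wiener_amalgam g -> ccontinuous g ->
  exists (a0 Gam : R) (beta : int -> R), [/\ 0 < a0, (forall j, 0 <= beta j),
    (forall y, normc (g y) <= beta (- Num.floor (y / a0))),
    (forall J, uniq J -> \sum_(j <- J) beta j <= Gam) &
    forall e, 0 < e -> exists A : seq int, forall J, uniq J ->
      {in J, forall j, j \notin A} -> \sum_(j <- J) beta j <= e].
Proof.
move=> [_ [a0 a00 an]] cg.
pose B (n : int) := cLnorm +oo%E (fun t => translation (n%:~R * a0) g t * \1_(`[0, a0[) t).
have B0 n : (0 <= B n)%E by rewrite /B /cLnorm; exact: Lnorm_ge0.
have Bfin n : B n \is a fin_num.
  rewrite ge0_fin_numE//; apply: le_lt_trans an.
  by have := seq_sum_le_esum B (isT : uniq [:: n]); rewrite big_seq1.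
have Gfin : amalgam_norm g a0 \is a fin_num.
  by rewrite ge0_fin_numE//; apply: esum_ge0 => n _; exact: B0.
have sumB J : \sum_(j <- J) fine (B j) = fine (\sum_(j <- J) B j)%E.
  by rewrite sum_fine.
have sumBfin J : (\sum_(j <- J) B j)%E \is a fin_num.
  by apply/sum_fin_numP => j _ _.
exists a0, (fine (amalgam_norm g a0)), (fun n => fine (B n)); split => //.
- by move=> j; exact: fine_ge0.
- move=> y; rewrite -lee_fin fineK//.
  pose j := - Num.floor (y / a0).
  have /(@cLnorm_infty_ge g a0 (j%:~R * a0) _ cg) : 0 <= y + j%:~R * a0 < a0.
    have /andP[] := floor_itv (y / a0).
    rewrite ler_pdivlMr// ltr_pdivrMr// /j intrD mulrDl mul1r mulrNz mulNr subr_ge0 => -> h.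
    by rewrite ltrBlDl.
  by rewrite addrK.
- by move=> J uJ; rewrite sumB fine_le//; exact: seq_sum_le_esum.
- move=> e e0.
  have : (amalgam_norm g a0 - e%:E < amalgam_norm g a0)%E.
    by rewrite lteBlDr// lteDl// lte_fin.
  move=> /lt_esum_seq[A uA HA]; exists A => J uJ JA.
  have uAJ : uniq (A ++ J).
    by rewrite cat_uniq uA uJ andbT/=; apply/hasPn => j /JA.
  have := seq_sum_le_esum B uAJ; rewrite -/(amalgam_norm g a0).
  rewrite big_cat/= -(fineK (sumBfin A)) -(fineK (sumBfin J)) -(fineK Gfin) -EFinD lee_fin.
  move: HA; rewrite -/B -(fineK (sumBfin A)) -{1}(fineK Gfin) -EFinB lte_fin sumB.
  by lra.
Qed.

(** When a0 <= q d, two points y - n d in the same cell of length a0 whose indices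
are congruent modulo q coincide. So n is determined by its cell and its residue,
and each cell is used at most q times. All bounds are uniform in y, in d and in
the finite index set, so that they apply both to steps near a and to large
steps 1/b. *)
Lemma amalgam_sums g : wiener_amalgam g -> ccontinuous g ->
  exists a0 Gam : R, [/\ 0 < a0, 0 <= Gam,
    (forall (d : R) (q : nat) (y : R) (J : seq int), 0 < d -> a0 <= q%:R * d -> uniq J ->
       \sum_(n <- J) normc (g (y - n%:~R * d)) <= q%:R * Gam) &
    forall e, 0 < e -> exists X : R, forall (d : R) (q : nat) (y : R) (J : seq int),
       0 < d -> a0 <= q%:R * d -> uniq J ->
       \sum_(n <- J | X <= `|y - n%:~R * d|) normc (g (y - n%:~R * d)) <= q%:R * e].
Proof.
move=> gW cg; have [a0 [Gam [beta [a00 b0 gb bG bt]]]] := amalgam_majorant gW cg.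
have key (d : R) (q : nat) (y C : R) (J : seq int) : 0 < d -> a0 <= q%:R * d -> uniq J ->
    (forall J', uniq J' -> {subset J' <= [seq - Num.floor ((y - n%:~R * d) / a0) | n <- J]} ->
      \sum_(j <- J') beta j <= C) ->
    \sum_(n <- J) normc (g (y - n%:~R * d)) <= q%:R * C.
  move=> d0 qd uJ HC.
  pose jj (n : int) := - Num.floor ((y - n%:~R * d) / a0).
  have q0 : (0 < q)%N.
    by case: (posnP q) qd => // ->; rewrite mul0r leNgt a00.
  have jinj n n' : jj n = jj n' -> (n %% q)%Z = (n' %% q)%Z -> n = n'.
    move=> jn mn.
    have jn' : Num.floor ((y - n%:~R * d) / a0) = Num.floor ((y - n'%:~R * d) / a0).
      by apply: oppr_inj.
    have /andP[f1 f2] := floor_itv ((y - n%:~R * d) / a0).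
    have /andP[f3 f4] := floor_itv ((y - n'%:~R * d) / a0).
    rewrite -jn' in f3 f4.
    have lt1 : `|(n - n')%:~R * d| < a0.
      move: f1 f2 f3 f4; rewrite !ler_pdivlMr// !ltr_pdivrMr// intrD !mulrDl.
      set w := (Num.floor _)%:~R; rewrite intrB mulrBl => f1 f2 f3 f4.
      by rewrite ltr_norml; apply/andP; split; lra.
    have : `|(n - n')%:~R| < q%:R :> R.
      rewrite -(ltr_pM2r d0); apply: lt_le_trans qd.
      by rewrite -[X in _ * X](gtr0_norm d0) -normrM.
    rewrite -intr_norm pmulrn ltr_int => nq.
    move/eqP: mn; rewrite eqz_mod_dvd => /dvdzP[k nk].
    case: (eqVneq k 0) nk => [-> | k0 nk].
      by rewrite mul0r => /eqP; rewrite subr_eq0 => /eqP.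
    move: nq; rewrite nk normrM; have : 1 <= `|k| by rewrite -gtz0_ge1 normr_gt0.
    by nia.
  apply: (@le_trans _ _ (\sum_(n <- J) \sum_(r < q) (if (n %% q)%Z == r%:Z then beta (jj n) else 0))).
    apply: ler_sum => n _.
    have rq : (`|(n %% q)%Z| < q)%N by have := @ltz_pmod n q; have := @modz_ge0 n q; lia.
    rewrite (bigD1 (Ordinal rq))//= gez0_abs ?modz_ge0 ?eqxx//; last by lia.
    rewrite (le_trans (gb _))// lerDl sumr_ge0// => r _.
    by case: ifP.
  rewrite exchange_big/=.
  have -> : q%:R * C = \sum_(r < q) C by rewrite sumr_const card_ord mulr_natl.
  apply: ler_sum => r _; rewrite -big_mkcond -big_filter/= -(big_map jj xpredT).
  apply: HC.
    rewrite map_inj_in_uniq ?filter_uniq// => n n'.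
    by rewrite !mem_filter => /andP[/eqP nr _] /andP[/eqP n'r _] /jinj; apply; rewrite nr n'r.
  move=> _ /mapP[n + ->]; rewrite mem_filter => /andP[_ nJ].
  exact: map_f.
exists a0, Gam; split => //.
- by have := bG [::] isT; rewrite big_nil.
- by move=> d q y J d0 qd uJ; apply: key => // J' uJ' _; exact: bG.
- move=> e e0; have [A HA] := bt _ e0.
  (* Beyond X the cell of a point is not in A. *)
pose X := \sum_(j <- A) (`|j%:~R| + 1) * a0.
  exists X => d q y J d0 qd uJ; rewrite -big_filter.
  apply: key => //; first exact: filter_uniq.
  move=> J' uJ' sJ'; apply: HA => // j /sJ' /mapP[n]; rewrite mem_filter => /andP[Xn _] ->.
  apply/negP => jA; move: Xn; rewrite leNgt => /negP; apply.
  set z := y - _ in jA *.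
  have /andP[f1 f2] := floor_itv (z / a0).
  apply: (@lt_le_trans _ _ ((`|(- Num.floor (z / a0))%:~R| + 1) * a0)); last first.
    rewrite /X (big_rem _ jA)/= lerDl sumr_ge0// => k _.
    by rewrite mulr_ge0 ?addr_ge0// ltW.
  rewrite -ltr_pdivrMr// -[X in _ / X](gtr0_norm a00) -normf_div.
  rewrite mulrNz normrN; move: f1 f2; rewrite intrD; set w := (Num.floor _)%:~R => f1 f2.
  by rewrite ltr_norml; have := ler_norm w; have := ler_norm (- w); rewrite normrN; lra.
Qed.

End Amalgam.

(** * Square-integrable functions *)

Section SquareIntegrable.
Variable R : realType.
Implicit Types (u v : R -> R) (f e h : R -> R[i]).
Local Notation mu := (@lebesgue_measure R).

Lemma integrable_dominated u v : measurable_fun setT u ->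
  (forall t, `|u t| <= v t) -> mu.-integrable setT (EFin \o v) ->
  mu.-integrable setT (EFin \o u).
Proof.
move=> mu_ uv iv; apply: le_integrable iv => //; first exact/measurable_EFinP.
by move=> t _ /=; rewrite lee_fin (le_trans (uv t)) ?ler_norm.
Qed.

Lemma integrable_scale (c : R) u : mu.-integrable setT (EFin \o u) ->
  mu.-integrable setT (EFin \o (fun t => c * u t)).
Proof. by move=> iu; exact: (integrableZl measurableT c iu). Qed.

Lemma integrable_add u v : mu.-integrable setT (EFin \o u) ->
  mu.-integrable setT (EFin \o v) -> mu.-integrable setT (EFin \o (fun t => u t + v t)).
Proof. by move=> iu iv; exact: (integrableD measurableT iu iv). Qed.

Lemma measurable_nsq f : cmeasurable f -> measurable_fun setT (fun t => nsq (f t)).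
Proof. by move=> [m1 m2]; apply: measurable_funD; apply: measurable_funX. Qed.

Lemma ccontinuous_cmeasurable f : ccontinuous f -> cmeasurable f.
Proof. by move=> [c1 c2]; split; exact: continuous_measurable_fun. Qed.

Lemma cmeasurableM f e : cmeasurable f -> cmeasurable e ->
  cmeasurable (fun t => f t * e t).
Proof.
move=> [m1 m2] [n1 n2]; split.
  under eq_fun do rewrite cReM.
  by apply: measurable_funB; apply: measurable_funM.
under eq_fun do rewrite cImM.
by apply: measurable_funD; apply: measurable_funM.
Qed.

Lemma cmeasurableJ f : cmeasurable f -> cmeasurable (fun t => conjc (f t)).
Proof.
move=> [m1 m2]; split; first by under eq_fun do rewrite cReJ.
by under eq_fun do rewrite cImJ; exact: measurable_funN.
Qed.

Lemma cmeasurableD f e : cmeasurable f -> cmeasurable e ->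
  cmeasurable (fun t => f t + e t).
Proof.
move=> [m1 m2] [n1 n2]; split.
  by under eq_fun do rewrite cReD; exact: measurable_funD.
by under eq_fun do rewrite cImD; exact: measurable_funD.
Qed.

Lemma cmeasurableZ (c : R[i]) f : cmeasurable f -> cmeasurable (fun t => c * f t).
Proof. by apply: cmeasurableM; split=> /=; exact: measurable_cst. Qed.

Lemma cLnorm2_sqr f : (cLnorm 2%:E f ^+ 2 = \int[mu]_t (nsq (f t))%:E)%E.
Proof.
have c0 : (0 <= cLnorm 2%:E f)%E by rewrite /cLnorm; exact: Lnorm_ge0.
have -> : (cLnorm 2%:E f ^+ 2 = cLnorm 2%:E f `^ 2)%E.
  move: c0; case: (cLnorm 2%:E f) => [r| |]//=.
    by rewrite lee_fin => r0; rewrite powR_mulrn// EFin_expe.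
  by move=> _; rewrite pnatr_eq0 mulyy.
rewrite /cLnorm poweR_Lnorm ?pnatr_eq0//.
apply: eq_integral => t _ /=.
rewrite ger0_norm ?normc_ge0// -sqr_normc_nsq.
by rewrite powR_mulrn ?normc_ge0.
Qed.

Lemma L2P f : L2 f <-> cmeasurable f /\ mu.-integrable setT (EFin \o (fun t => nsq (f t))).
Proof.
have int_pos : (\int[mu]_t `|(EFin \o (fun t => nsq (f t))) t| = \int[mu]_t (nsq (f t))%:E)%E.
  by apply: eq_integral => t _ /=; rewrite ger0_norm ?nsq_ge0.
have c0 : (0 <= cLnorm 2%:E f)%E by rewrite /cLnorm; exact: Lnorm_ge0.
split=> -[mf H]; split=> //.
  apply/integrableP; split; first by apply/measurable_EFinP; exact: measurable_nsq.
  rewrite int_pos -cLnorm2_sqr.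
  by move: H c0; case: (cLnorm _ _) => [r| |]//= _ _; rewrite -EFinM ltry.
move/integrableP: H => [_]; rewrite int_pos -cLnorm2_sqr.
by move: c0; case: (cLnorm _ _) => [r| |]//= _; rewrite ?ltry// mulyy.
Qed.

Lemma cLnorm2_L2nsq f : L2 f -> (cLnorm 2%:E f ^+ 2 = (L2nsq f)%:E)%E.
Proof.
move=> /L2P[_ i]; rewrite cLnorm2_sqr /L2nsq /Rintegral fineK//.
exact: integrable_fin_num.
Qed.

Lemma L2nsq_ge0 f : 0 <= L2nsq f.
Proof. by apply: Rintegral_ge0 => t _; exact: nsq_ge0. Qed.

Lemma L2_add f e : L2 f -> L2 e -> L2 (fun t => f t + e t).
Proof.
move=> /L2P[mf i_f] /L2P[me i_e]; apply/L2P; split; first exact: cmeasurableD.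
apply: (@integrable_dominated _ (fun t => 2 * nsq (f t) + 2 * nsq (e t))).
- by apply: measurable_nsq; exact: cmeasurableD.
- by move=> t; rewrite ger0_norm ?nsq_ge0// nsqD_le.
- by apply: integrable_add; exact: integrable_scale.
Qed.

Lemma L2_scale (c : R[i]) f : L2 f -> L2 (fun t => c * f t).
Proof.
move=> /L2P[mf i_f]; apply/L2P; split; first exact: cmeasurableZ.
have -> : (fun t => nsq (c * f t)) = fun t => nsq c * nsq (f t).
  by apply/funext => t; rewrite nsqM.
exact: integrable_scale.
Qed.

Lemma L2nsqZ (c : R[i]) f : L2 f -> L2nsq (fun t => c * f t) = nsq c * L2nsq f.
Proof.
move=> /L2P[mf i_f]; rewrite /L2nsq -RintegralZl//.
by apply: eq_Rintegral => t _; rewrite nsqM.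
Qed.

Lemma L2_sub f e : L2 f -> L2 e -> L2 (fun t => f t - e t).
Proof.
move=> Lf /(L2_scale (- 1)) Le; have := L2_add Lf Le.
by congr L2; apply/funext => t; rewrite mulN1r.
Qed.

Lemma L2_mul_Re f e : L2 f -> L2 e ->
  mu.-integrable setT (EFin \o (fun t => complex.Re (f t * conjc (e t)))).
Proof.
move=> /L2P[mf i_f] /L2P[me i_e].
apply: (@integrable_dominated _ (fun t => nsq (f t) + nsq (e t))).
- by case: (cmeasurableM mf (cmeasurableJ me)).
- move=> t; apply: (le_trans (normr_Re_le _)); rewrite normcM normc_conj -!sqr_normc_nsq.
  have := sqr_ge0 (normc (f t) - normc (e t)).
  have := normc_ge0 (f t); have := normc_ge0 (e t); nra.
- exact: integrable_add.
Qed.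

(** Reduces imaginary parts of inner products to real parts. *)
Lemma mulI_conj (z w : R[i]) : complex.Re (z * conjc ('i%C * w)) = complex.Im (z * conjc w).
Proof. by case: z w => [x y] [u v] /=; ring. Qed.

Lemma L2_mul_Im f e : L2 f -> L2 e ->
  mu.-integrable setT (EFin \o (fun t => complex.Im (f t * conjc (e t)))).
Proof.
move=> Lf Le; have := L2_mul_Re Lf (L2_scale 'i%C Le).
by congr integrable; apply/funext => t /=; rewrite mulI_conj.
Qed.

Lemma L2nsqD f e : L2 f -> L2 e ->
  L2nsq (fun t => f t + e t) = L2nsq f + L2nsq e + 2 * complex.Re (L2inner f e).
Proof.
move=> Lf Le; have /L2P[_ i_f] := Lf; have /L2P[_ i_e] := Le.
have i_r := L2_mul_Re Lf Le.
rewrite /L2nsq /L2inner /= -RintegralZl// -RintegralD// -RintegralD//.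
- by apply: eq_Rintegral => t _; rewrite nsqD.
- exact: integrable_add.
- exact: integrable_scale.
Qed.

(** A substitute for the triangle inequality that needs no square roots. *)
Lemma L2nsqB_le f e : L2 f -> L2 e -> L2nsq f <= 2 * L2nsq (fun t => f t - e t) + 2 * L2nsq e.
Proof.
move=> Lf Le; have /L2P[_ i_f] := Lf; have /L2P[_ i_e] := Le.
have /L2P[_ i_d] := L2_sub Lf Le.
have i1 : mu.-integrable setT (EFin \o (fun t => 2 * nsq (f t - e t))) by exact: integrable_scale.
have i2 : mu.-integrable setT (EFin \o (fun t => 2 * nsq (e t))) by exact: integrable_scale.
rewrite /L2nsq -RintegralZl// -RintegralZl// -RintegralD//.
apply: le_Rintegral => //; first exact: integrable_add.
by move=> t _; rewrite -{1}(subrK (e t) (f t)) nsqD_le.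
Qed.

Lemma discriminant_le (X Y Z : R) : 0 <= Y ->
  (forall l, 0 <= X + l ^+ 2 * Y + 2 * (l * Z)) -> Z ^+ 2 <= X * Y.
Proof.
move=> Y0 H; have [Y0'|Yn0] := eqVneq Y 0.
  have [->|Z0] := eqVneq Z 0; first by rewrite Y0' mulr0 expr0n.
  have := H (- (X + 1) / (2 * Z)); rewrite Y0' mulr0 addr0.
  have -> : 2 * (- (X + 1) / (2 * Z) * Z) = - (X + 1) by field.
  by lra.
have Yp : 0 < Y by rewrite lt_def Yn0.
have := H (- Z / Y).
have -> : X + (- Z / Y) ^+ 2 * Y + 2 * (- Z / Y * Z) = X - Z ^+ 2 / Y by field.
by rewrite subr_ge0 ler_pdivrMr.
Qed.

Lemma Re_L2inner_sqr f e : L2 f -> L2 e ->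
  complex.Re (L2inner f e) ^+ 2 <= L2nsq f * L2nsq e.
Proof.
move=> Lf Le; apply: discriminant_le; first exact: L2nsq_ge0.
move=> l; have Ll := L2_scale l%:C Le.
have := L2nsq_ge0 (fun t => f t + l%:C * e t).
rewrite L2nsqD// L2nsqZ// nsq_real.
suff -> : complex.Re (L2inner f (fun t => l%:C * e t)) = l * complex.Re (L2inner f e) by [].
rewrite /L2inner /= -RintegralZl//; last exact: L2_mul_Re.
apply: eq_Rintegral => t _.
by case: (f t) (e t) => [x y] [u v] /=; ring.
Qed.

(** The Cauchy-Schwarz inequality, with a factor 2 because the real and imaginary
parts are bounded separately. *)
Lemma L2inner_le f e : L2 f -> L2 e -> nsq (L2inner f e) <= 2 * (L2nsq f * L2nsq e).
Proof.
move=> Lf Le; have h1 := Re_L2inner_sqr Lf Le.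
have := Re_L2inner_sqr Lf (L2_scale 'i%C Le).
rewrite L2nsqZ// (_ : nsq 'i%C = 1) ?mul1r; last by rewrite /nsq /=; ring.
have -> : complex.Re (L2inner f (fun t => 'i%C * e t)) = complex.Im (L2inner f e).
  by apply: eq_Rintegral => t _; rewrite mulI_conj.
by rewrite /nsq; lra.
Qed.

Lemma L2innerB f h e : L2 f -> L2 h -> L2 e ->
  L2inner (fun t => f t - h t) e = L2inner f e - L2inner h e.
Proof.
move=> Lf Lh Le; apply/eqP; rewrite eq_complex cReD cReN cImD cImN /=.
rewrite -RintegralB//; try exact: L2_mul_Re.
rewrite -RintegralB//; try exact: L2_mul_Im.
by apply/andP; split; apply/eqP; apply: eq_Rintegral => t _;
  case: (f t) (h t) (e t) => [x y] [x' y'] [u v] /=; ring.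
Qed.

Lemma L2_compact_support f (L : R) : ccontinuous f -> (forall t, L < `|t| -> f t = 0) -> L2 f.
Proof.
move=> cf f0; apply/L2P; split; first exact: ccontinuous_cmeasurable.
apply: (@integrable_compact_support R _ L); first exact: continuous_nsq.
by move=> t tL; rewrite f0// nsq0.
Qed.

End SquareIntegrable.

(** * Density of compactly supported continuous functions in L^2 *)

Section Density.
Variable R : realType.
Implicit Types (u v : R -> R) (f : R -> R[i]).
Local Notation mu := (@lebesgue_measure R).

Lemma continuous_maxr u v : continuous u -> continuous v ->
  continuous (fun t => Num.max (u t) (v t)).
Proof. by move=> cu cv t; exact: (@continuous_max R R u v t (cu t) (cv t)). Qed.

Lemma continuous_minr u v : continuous u -> continuous v ->
  continuous (fun t => Num.min (u t) (v t)).
Proof. by move=> cu cv t; exact: (@continuous_min R R u v t (cu t) (cv t)). Qed.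

(** Dominated convergence, with u^2 as dominating function. *)
Lemma truncation_cvg u : measurable_fun setT u ->
  mu.-integrable setT (EFin \o (fun t => u t ^+ 2)) -> forall e, 0 < e ->
  exists n : nat, let A := [set t | `|t| <= n.+1%:R /\ `|u t| <= n.+1%:R] in
    measurable A /\ \int[mu]_t (u t - (u \_ A) t) ^+ 2 <= e.
Proof.
move=> mu_ iu e e0.
pose A n := [set t | `|t| <= n.+1%:R /\ `|u t| <= n.+1%:R].
have mA n : measurable (A n).
  have -> : A n = `[- n.+1%:R, n.+1%:R] `&` (setT `&` u @^-1` `[- n.+1%:R, n.+1%:R]).
    apply/seteqP; split=> t /=; rewrite !in_itv/= -!ler_norml.
      by move=> [].
    by move=> [? []].
  by apply: measurableI => //; exact: mu_.
pose w n t := (u t - (u \_ (A n)) t) ^+ 2.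
have mw n : measurable_fun setT (w n).
  apply: measurable_funX; apply: measurable_funB => //.
  by apply/(measurable_restrictT _ _).1 => //; exact: measurable_funTS.
have wle n t : `|w n t| <= u t ^+ 2.
  rewrite /w patchE; case: ifP => _; first by rewrite subrr expr0n normr0 sqr_ge0.
  by rewrite subr0 ger0_norm ?sqr_ge0.
have iw n : mu.-integrable setT (EFin \o w n) by apply: integrable_dominated iu.
have [| | | | |_ _] := @dominated_convergence _ _ R mu setT measurableT
    (fun n => EFin \o w n) (cst 0%E) (EFin \o (fun t => u t ^+ 2)).
- by move=> n; apply/measurable_EFinP; exact: mw.
- exact: measurable_cst.
- apply: aeW => t _; apply: cvg_near_cst.
  exists (Num.truncn (Num.max `|t| `|u t|)) => // n /= tn.
  have : Num.max `|t| `|u t| < n.+1%:R.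
    by rewrite (lt_le_trans (truncnS_gt _))// ler_nat.
  rewrite gt_max => /andP[h1 h2].
  rewrite /w patchE ifT ?subrr ?expr0n// inE.
  by split; exact: ltW.
- exact: iu.
- by apply: aeW => t n _; rewrite /= lee_fin; exact: wle.
rewrite integral_cst// mul0e => /fine_cvgP[_ /cvgrPdist_le/(_ _ e0)[n _ /(_ n (leqnn n))]].
rewrite /= sub0r normrN => H; exists n; split; first exact: mA.
by apply: le_trans H; rewrite ler_norm.
Qed.

(** Truncate u in range and support to v with values in [- M, M], approximate v in
L^1 by a continuous function, clip the latter to [- M, M], and bring it to 0
while |t| goes from M to M + 1, where v vanishes. Between two functions bounded by M, the
squared L^2 distance is at most 2M times the L^1 distance. *)
Lemma L2_dense_real u : measurable_fun setT u ->
  mu.-integrable setT (EFin \o (fun t => u t ^+ 2)) -> forall e, 0 < e ->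
  exists (phi : R -> R) (L : R), [/\ continuous phi, (forall t, L < `|t| -> phi t = 0),
    mu.-integrable setT (EFin \o (fun t => (u t - phi t) ^+ 2)) &
    \int[mu]_t (u t - phi t) ^+ 2 <= e].
Proof.
move=> mu_ iu e e0; have e40 : 0 < e / 4 by rewrite divr_gt0.
have [n /= [mA HA]] := truncation_cvg mu_ iu e40.
set A := [set t | _] in mA HA; set M : R := n.+1%:R in A mA HA.
have M0 : 0 < M by rewrite ltr0n.
pose v : R -> R := u \_ A.
have vM t : `|v t| <= M.
  rewrite /v patchE; case: ifPn; last by rewrite normr0 ltW.
  by rewrite inE => -[].
have vM0 t : M < `|t| -> v t = 0.
  move=> Mt; rewrite /v patchE; case: ifPn => //; rewrite inE => -[].
  by rewrite leNgt Mt.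
have mv : measurable_fun setT v.
  by apply/(measurable_restrictT _ _).1 => //; exact: measurable_funTS.
pose E : set R := [set` `[- (M + 1), M + 1]].
have mE : measurable (E : set (measurableTypeR R)) by exact: measurable_itv.
have Efin : (mu E < +oo)%E.
  by apply: compact_finite_measure; exact: segment_compact.
have iv : mu.-integrable E (EFin \o v).
  apply: measurable_bounded_integrable => //; first exact: measurable_funTS.
  by exists M; split; rewrite ?num_real// => x Mx t _ /=; rewrite (le_trans _ (ltW Mx)).
have [g_ [cg ig gcvg]] := approximation_continuous_integrable mE Efin iv.
have e8 : 0 < e / (8 * M) by rewrite divr_gt0// mulr_gt0.
have /fine_cvgP[_ /cvgrPdist_le/(_ _ e8)[k _ /(_ k (leqnn k))]] := gcvg.
rewrite /= sub0r normrN => Hk.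
(* Clipping to [- M, M], where v takes its values, brings psi closer to v. *)
pose psi t := Num.max (- M) (Num.min M (g_ k t)).
pose chi (t : R) : R := Num.max 0 (Num.min 1 (M + 1 - `|t|)).
have cpsi : continuous psi.
  apply: continuous_maxr; first by move=> t; exact: cvg_cst.
  by apply: continuous_minr => // t; exact: cvg_cst.
have cchi : continuous chi.
  apply: continuous_maxr; first by move=> t; exact: cvg_cst.
  apply: continuous_minr => t; first exact: cvg_cst.
  by apply: cvgB; [exact: cvg_cst | exact: norm_continuous].
pose phi t := chi t * psi t.
have cphi : continuous phi by exact: continuous_mul.
have phi0 t : M + 1 < `|t| -> phi t = 0.
  move=> tM; rewrite /phi /chi; have -> : Num.max 0 (Num.min 1 (M + 1 - `|t|)) = 0 :> R.
    by apply/max_idPl; rewrite ge_min; apply/orP; right; rewrite subr_le0 ltW.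
  by rewrite mul0r.
have chi01 t : 0 <= chi t <= 1.
  by rewrite /chi le_max lexx/= ge_max ler01 ge_min lexx.
have chi1 t : `|t| <= M -> chi t = 1.
  move=> tM; rewrite /chi; have -> : Num.min 1 (M + 1 - `|t|) = 1 :> R.
    by apply/min_idPl; lra.
  by apply/max_idPr.
have psiM t : `|psi t| <= M.
  rewrite ler_norml /psi le_max lexx/= ge_max ge_min lexx andbT.
  by rewrite -subr_ge0 opprK addr_ge0// ltW.
have psiv t : `|v t - psi t| <= `|v t - g_ k t|.
  have := vM t; rewrite ler_norml => /andP[v1 v2]; rewrite /psi.
  have [gM|gM] := leP M (g_ k t).
    rewrite max_r; last by lra.
    by rewrite !ler0_norm; lra.
  have [gN|gN] := leP (g_ k t) (- M).
    by rewrite !ger0_norm; lra.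
  by [].
have phiv t : (v t - phi t) ^+ 2 <= 2 * M * `|v t - g_ k t|.
  have h1 : `|v t - phi t| <= `|v t - psi t|.
    have [tM|tM] := leP `|t| M; first by rewrite /phi chi1// mul1r.
    rewrite vM0// !sub0r !normrN /phi normrM ger0_norm; last by case/andP: (chi01 t).
    by rewrite ler_piMl//; case/andP: (chi01 t).
  have h2 : `|v t - phi t| <= 2 * M.
    apply: (le_trans h1); apply: (le_trans (ler_normB _ _)).
    by rewrite mulr_natl mulr2n lerD.
  rewrite -real_normK ?num_real// expr2.
  by apply: ler_pM => //; exact: le_trans h1 (psiv t).
have mphi : measurable_fun setT phi by exact: continuous_measurable_fun.
have ivphi : mu.-integrable setT (EFin \o (fun t => (v t - phi t) ^+ 2)).
  have -> : EFin \o (fun t => (v t - phi t) ^+ 2) = (EFin \o (fun t => (v t - phi t) ^+ 2)) \_ E.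
    apply/funext => t; rewrite patchE; case: ifPn => // tE /=.
    have tM : M + 1 < `|t|.
      rewrite ltNge; apply/negP => tM; move/negP: tE; apply.
      by rewrite inE /E /= in_itv/= -ler_norml.
    by rewrite phi0// vM0 ?subrr ?expr0n//; lra.
  apply/integrable_restrict => //; rewrite setTI.
  apply: measurable_bounded_integrable => //.
    by apply: measurable_funTS; apply: measurable_funX; exact: measurable_funB.
  exists ((2 * M) * (2 * M)); split; rewrite ?num_real// => x Mx t _ /=.
  rewrite (le_trans _ (ltW Mx))// ger0_norm ?sqr_ge0//.
  rewrite -real_normK ?num_real// expr2.
  suff h2 : `|v t - phi t| <= 2 * M by apply: ler_pM.
  apply: (le_trans (ler_normB _ _)); rewrite mulr_natl mulr2n lerD//.
  rewrite /phi normrM ger0_norm; last by case/andP: (chi01 t).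
  by rewrite -[leRHS]mul1r ler_pM//; case/andP: (chi01 t).
have Ivphi : \int[mu]_t (v t - phi t) ^+ 2 <= e / 4.
  rewrite (@Rintegral_compact_support R _ E)//; last first.
    move=> t tE; have tM : M + 1 < `|t|.
      rewrite ltNge; apply/negP => tM; apply: tE.
      by rewrite /E /= in_itv/= -ler_norml.
    by rewrite phi0// vM0 ?subrr ?expr0n//; lra.
  have iabs : mu.-integrable E (EFin \o (fun t => `|v t - g_ k t|)).
    apply: (@integrable_norm _ _ R mu E (fun t => v t - g_ k t)).
    have -> : EFin \o (fun t => v t - g_ k t) =
      (fun t => (EFin \o v) t - (EFin \o g_ k) t)%E by [].
    by apply: integrableB.
  apply: (@le_trans _ _ (\int[mu]_(t in E) (2 * M * `|v t - g_ k t|))).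
    apply: le_Rintegral => //.
    - by apply: integrableS ivphi.
    - exact: (integrableZl mE (2 * M) iabs).
  rewrite RintegralZl//.
  apply: (@le_trans _ _ (2 * M * (e / (8 * M)))).
    rewrite ler_pM2l ?mulr_gt0//; apply: le_trans Hk; exact: ler_norm.
  by rewrite le_eqVlt; apply/orP; left; apply/eqP; field; rewrite gt_eqF.
have iuv : mu.-integrable setT (EFin \o (fun t => (u t - v t) ^+ 2)).
  apply: integrable_dominated iu.
    by apply: measurable_funX; exact: measurable_funB.
  move=> t; rewrite /v patchE; case: ifP => _; first by rewrite subrr expr0n normr0 sqr_ge0.
  by rewrite subr0 ger0_norm ?sqr_ge0.
have i2 : mu.-integrable setT (EFin \o (fun t => 2 * (u t - v t) ^+ 2 + 2 * (v t - phi t) ^+ 2)).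
  by apply: integrable_add; exact: integrable_scale.
have le2 t : (u t - phi t) ^+ 2 <= 2 * (u t - v t) ^+ 2 + 2 * (v t - phi t) ^+ 2.
  by have := sqr_ge0 ((u t - v t) - (v t - phi t)); lra.
have iuphi : mu.-integrable setT (EFin \o (fun t => (u t - phi t) ^+ 2)).
  apply: integrable_dominated i2.
    by apply: measurable_funX; exact: measurable_funB.
  by move=> t; rewrite ger0_norm ?sqr_ge0.
exists phi, (M + 1); split => //.
apply: (@le_trans _ _ (\int[mu]_t (2 * (u t - v t) ^+ 2 + 2 * (v t - phi t) ^+ 2))).
  exact: le_Rintegral.
rewrite RintegralD//; try exact: integrable_scale.
by rewrite !RintegralZl//; move: HA Ivphi; rewrite -/v; lra.
Qed.

Lemma L2_dense f (e : R) : L2 f -> 0 < e ->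
  exists (h : R -> R[i]) (L : R), [/\ ccontinuous h, (forall t, L < `|t| -> h t = 0) &
    L2nsq (fun t => f t - h t) <= e].
Proof.
move=> /L2P[[m1 m2] i_f] e0; have e20 : 0 < e / 2 by rewrite divr_gt0.
have i1 : mu.-integrable setT (EFin \o (fun t => complex.Re (f t) ^+ 2)).
  apply: integrable_dominated i_f; first exact: measurable_funX.
  by move=> t; rewrite ger0_norm ?sqr_ge0// lerDl sqr_ge0.
have i2 : mu.-integrable setT (EFin \o (fun t => complex.Im (f t) ^+ 2)).
  apply: integrable_dominated i_f; first exact: measurable_funX.
  by move=> t; rewrite ger0_norm ?sqr_ge0// lerDr sqr_ge0.
have [p1 [L1 [cp1 z1 j1 H1]]] := L2_dense_real m1 i1 e20.
have [p2 [L2 [cp2 z2 j2 H2]]] := L2_dense_real m2 i2 e20.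
exists (fun t => p1 t +i* p2 t), (Num.max L1 L2); split => //.
  by move=> t; rewrite gt_max => /andP[t1 t2]; rewrite z1// z2.
rewrite /L2nsq.
have -> : \int[mu]_t nsq (f t - (p1 t +i* p2 t)) =
    \int[mu]_t ((complex.Re (f t) - p1 t) ^+ 2 + (complex.Im (f t) - p2 t) ^+ 2).
  by apply: eq_Rintegral => t _; rewrite /nsq cReD cReN cImD cImN.
by rewrite RintegralD//; lra.
Qed.

End Density.

(** * Square-integrability of the Weyl-Heisenberg system *)

Section WHsystemL2.
Variable R : realType.
Local Notation mu := (@lebesgue_measure R).

(** Modulations preserve the modulus and translations preserve the integral. *)
Lemma L2_WHsystem (g : R -> R[i]) a b k : L2 g -> ccontinuous g -> L2 (WHsystem g a b k).
Proof.
move=> /L2P[mg ig] cg; apply/L2P.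
pose c := k.2%:~R * a.
have cW : ccontinuous (WHsystem g a b k).
  apply: ccontinuousM.
    exact: (ccontinuous_cis (@continuous_linear R (2 * pi * (k.1%:~R * b)))).
  exact: (ccontinuous_comp cg (@continuous_shift_by R (- c))).
split; first exact: ccontinuous_cmeasurable.
have E t : nsq (WHsystem g a b k t) = nsq (g (t - c)).
  by rewrite /WHsystem /modulation nsqM (nsq_cis (2 * pi * (k.1%:~R * b) * t)) mul1r.
apply/integrableP; split.
  by apply/measurable_EFinP; apply: measurable_nsq; exact: ccontinuous_cmeasurable.
move/integrableP: ig => [_]; apply: le_lt_trans.
have -> : (\int[mu]_t `|(EFin \o (fun t => nsq (g t))) t| = \int[mu]_t (nsq (g t))%:E)%E.
  by apply: eq_integral => t _ /=; rewrite ger0_norm ?nsq_ge0.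
have dF (y : R) : is_derive y (1 : R) (fun t => t - c) (1 : R).
  by apply: is_derive_eq; rewrite oppr0 addr0.
have dE : derive1 (fun t : R => t - c) = cst 1.
  by apply/funext => y; rewrite derive1E; exact: derive_val.
rewrite (@increasing_ge0_integration_by_substitutionT R (fun t => t - c) (fun t => nsq (g t))).
- rewrite le_eqVlt; apply/orP; left; apply/eqP; apply: eq_integral => t _ /=.
  by rewrite ger0_norm ?nsq_ge0// E dE /= mulr1.
- by move=> x y; rewrite ltrD2r.
- by rewrite dE => y; exact: cvg_cst.
- by rewrite dE; exact: is_cvg_cst.
- by rewrite dE; exact: is_cvg_cst.
- by move=> x; apply: ex_derive.
- apply/cvgrNyPle => A; near=> x; rewrite lerBlDr; near: x.
  by apply: nbhs_ninfty_le; rewrite num_real.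
- apply/cvgryPge => A; near=> x; rewrite lerBrDr; near: x.
  by apply: nbhs_pinfty_ge; rewrite num_real.
- exact: continuous_nsq.
- by move=> x; exact: nsq_ge0.
Unshelve. all: by end_near.
Qed.

End WHsystemL2.

(** * From test functions to frames *)

Section FrameCriterion.
Variable R : realType.

Lemma box_sum_le_esum (F : int * int -> R) (J : seq int) N : uniq J ->
  ((\sum_(n <- J) \sum_(m <- zbox N) F (m, n))%:E <= \esum_(k in [set: int * int]) (F k)%:E)%E.
Proof.
move=> uJ; pose s := [seq (m, n) | n <- J, m <- zbox N].
have us : uniq s.
  apply: allpairs_uniq => //; first exact: zbox_uniq.
  by move=> [n m] [n' m'] _ _ /= [-> ->].
have -> : \sum_(n <- J) \sum_(m <- zbox N) F (m, n) = \sum_(k <- s) F k.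
  by rewrite /s big_allpairs_dep.
by rewrite -sumEFin; exact: seq_sum_le_esum.
Qed.

(** Every finite set of pairs lies in some box. *)
Lemma esum_le_box (F : int * int -> R) (C : R) : (forall k, 0 <= F k) ->
  (forall N, \sum_(n <- zbox N) \sum_(m <- zbox N) F (m, n) <= C) ->
  (\esum_(k in [set: int * int]) (F k)%:E <= C%:E)%E.
Proof.
move=> F0 HC; rewrite leNgt; apply/negP => /lt_esum_seq[J uJ].
rewrite sumEFin lte_fin ltNge => /negP; apply.
pose N := (\sum_(k <- J) (`|k.1| + `|k.2|))%N.
pose s := [seq (m, n) | n <- zbox N, m <- zbox N].
apply: le_trans (HC N).
have -> : \sum_(n <- zbox N) \sum_(m <- zbox N) F (m, n) = \sum_(k <- s) F k.
  by rewrite /s big_allpairs_dep.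
apply: le_sum_uniq_sub => //.
  apply: allpairs_uniq; try exact: zbox_uniq.
  by move=> [n m] [n' m'] _ _ /= [-> ->].
move=> [m n] kJ; apply/allpairsP; exists (n, m) => /=.
have : (`|m| + `|n| <= N)%N by rewrite /N (big_rem _ kJ)/= leq_addr.
by rewrite !mem_zbox => h; split => //; lia.
Qed.

Variable e : int * int -> R -> R[i].
Hypothesis Le : forall k, L2 (e k).

Definition boxsum (J : seq int) N (f : R -> R[i]) : R :=
  \sum_(n <- J) \sum_(m <- zbox N) nsq (L2inner f (e (m, n))).

Lemma boxsum_split J N f h : L2 f -> L2 h ->
  boxsum J N h <= 2 * boxsum J N f + 2 * boxsum J N (fun t => f t - h t).
Proof.
move=> Lf Lh; rewrite /boxsum !mulr_sumr -big_split/=; apply: ler_sum => n _.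
rewrite !mulr_sumr -big_split/=; apply: ler_sum => m _.
rewrite L2innerB// -[X in nsq X <= _](subKr (L2inner f (e (m, n)))).
by apply: (le_trans (nsqD_le _ _)); rewrite nsqN.
Qed.

Lemma le_of_le_add_linear (x y C : R) : (forall d, 0 < d -> x <= y + C * d) -> x <= y.
Proof.
move=> H; apply/ler_addgt0Pr => d d0.
have C1 : 0 < `|C| + 1 by rewrite ltr_wpDl.
have := H (d / (`|C| + 1)) (divr_gt0 d0 C1); move=> /le_trans; apply.
rewrite lerD2l mulrCA ler_piMr ?(ltW d0)// ler_pdivrMr// mul1r.
by rewrite (le_trans (ler_norm C))// lerDl.
Qed.

(** For the upper bound, a finite partial sum is continuous for the L^2 norm, by
Cauchy-Schwarz, with a constant depending on the box; the bound itself does not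
depend on it. Once the upper bound holds on L^2, it controls the error made in
the lower bound when f is replaced by a test function. The factors 4 come from
using |x + y|^2 <= 2 |x|^2 + 2 |y|^2 in place of the triangle inequality. *)
Lemma frame_from_test (c D : R) : 0 < c -> 0 < D ->
  (forall f L, ccontinuous f -> (forall t, L < `|t| -> f t = 0) ->
     (forall N, boxsum (zbox N) N f <= D * L2nsq f) /\
     (forall d, 0 < d -> exists J N, uniq J /\ c * L2nsq f - d <= boxsum J N f)) ->
  L2frame e.
Proof.
move=> c0 D0 Htest; split; first exact: Le.
have upper f : L2 f -> forall N, boxsum (zbox N) N f <= 4 * D * L2nsq f.
  move=> Lf N.
  pose C := \sum_(n <- zbox N) \sum_(m <- zbox N) 2 * L2nsq (e (m, n)).
  apply: (@le_of_le_add_linear _ _ (4 * D + 2 * C)) => d d0.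
  have [h [L [ch h0 hd]]] := L2_dense Lf d0.
  have Lh : L2 h by exact: L2_compact_support h0.
  have [/(_ N) Hu _] := Htest h L ch h0.
  have Ld := L2_sub Lf Lh.
  have Lz : L2 (fun t => h t - f t) by exact: L2_sub.
  have nz : L2nsq (fun t => h t - f t) = L2nsq (fun t => f t - h t).
    by apply: eq_Rintegral => t _; rewrite -nsqN opprB.
  have h1 := boxsum_split (zbox N) N Lh Lf.
  have h2 : boxsum (zbox N) N (fun t => h t - f t) <= C * d.
    rewrite /C mulr_suml; apply: ler_sum => n _; rewrite mulr_suml; apply: ler_sum => m _.
    apply: (le_trans (L2inner_le Lz (Le _))).
    rewrite nz -mulrA ler_pM2l// mulrC ler_wpM2l ?L2nsq_ge0//.
  have h3 := L2nsqB_le Lh Lf; rewrite nz in h3.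
  have h4 : D * L2nsq h <= D * (2 * d + 2 * L2nsq f).
    by rewrite ler_pM2l//; lra.
  by lra.
exists (c / 4), (4 * D); split; rewrite ?mulr_gt0// ?divr_gt0// => f Lf.
have F0 f' k : 0 <= (normc (L2inner f' (e k))) ^+ 2 by rewrite sqr_ge0.
have boxE J N f' : \sum_(n <- J) \sum_(m <- zbox N) normc (L2inner f' (e (m, n))) ^+ 2 = boxsum J N f'.
  by apply: eq_bigr => n _; apply: eq_bigr => m _; rewrite sqr_normc_nsq.
have esum_up f' : L2 f' -> (\esum_(i in [set: int * int]) ((normc (L2inner f' (e i))) ^+ 2)%:E <=
    (4 * D * L2nsq f')%:E)%E.
  by move=> Lf'; apply: esum_le_box => // N; rewrite boxE; exact: upper.
rewrite cLnorm2_L2nsq// -!EFinM; split; last exact: esum_up.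
set S := \esum_(i in _) _.
have S0 : (0 <= S)%E by apply: esum_ge0 => k _; rewrite lee_fin.
have Sfin : S \is a fin_num.
  by rewrite ge0_fin_numE// (le_lt_trans (esum_up _ Lf))// ltry.
rewrite -(fineK Sfin) lee_fin.
suff : c * L2nsq f <= 4 * fine S by lra.
apply: (@le_of_le_add_linear _ _ (2 * c + 2 + 16 * D)) => d d0.
have [h [L [ch h0 hd]]] := L2_dense Lf d0.
have Lh : L2 h by exact: L2_compact_support h0.
have [_ /(_ d d0) [J [N [uJ HJ]]]] := Htest h L ch h0.
have Ld := L2_sub Lf Lh.
have h1 := boxsum_split J N Lf Lh.
have h2 : boxsum J N f <= fine S.
  rewrite -lee_fin (fineK Sfin) -boxE.
  exact: (box_sum_le_esum (fun k => normc (L2inner f (e k)) ^+ 2)).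
have h3 : boxsum J N (fun t => f t - h t) <= 4 * D * d.
  rewrite -lee_fin -boxE.
  apply: (le_trans (box_sum_le_esum (fun k => normc (L2inner (fun t => f t - h t) (e k)) ^+ 2) _ uJ)).
  by apply: (le_trans (esum_up _ Ld)); rewrite lee_fin ler_pM2l// mulr_gt0.
have h4 := L2nsqB_le Lf Lh.
have h5 : c * L2nsq f <= c * (2 * d + 2 * L2nsq h) by rewrite ler_pM2l//; lra.
by lra.
Qed.

End FrameCriterion.

(** * The lower frame bound bounds G_a from below *)

Section Necessity.
Variables (R : realType) (g : R -> R[i]) (a b : R).
Hypotheses (b0 : 0 < b) (cg : ccontinuous g).
Local Notation mu := (@lebesgue_measure R).

Definition bump (t0 r t : R) : R[i] := (Num.max 0 (r - `|t - t0|))%:C.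

Lemma ccontinuous_bump t0 r : ccontinuous (bump t0 r).
Proof.
split=> /=; last by move=> t; exact: cvg_cst.
apply: continuous_maxr; first by move=> t; exact: cvg_cst.
apply: continuous_sub; first by move=> t; exact: cvg_cst.
move=> t; apply: (@continuous_comp _ _ _ (fun t => t - t0) (fun x => `|x|)).
  exact: continuous_shift_by.
exact: norm_continuous.
Qed.

Lemma bump_eq0 t0 r t : r <= `|t - t0| -> bump t0 r t = 0.
Proof. by move=> h; rewrite /bump; congr (_ %:C); apply/max_idPl; rewrite subr_le0. Qed.

Lemma bump_far t0 r t : `|t0| + r < `|t| -> bump t0 r t = 0.
Proof.
move=> h; apply: bump_eq0; have := ler_normB (t - t0) (- t0).
by rewrite opprK subrK normrN; lra.
Qed.

(** The bump is at least r/2 on an interval of length r. *)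
Lemma L2nsq_bump_gt0 t0 r : 0 < r -> 0 < L2nsq (bump t0 r).
Proof.
move=> r0; have r20 : 0 < r / 2 by rewrite divr_gt0.
pose I : set R := [set` `[t0 - r / 2, t0 - r / 2 + r]].
have cc : continuous (fun _ : R => (r / 2) ^+ 2) by move=> t; exact: cvg_cst.
have iI : mu.-integrable setT (EFin \o ((fun=> (r / 2) ^+ 2) \_ I)).
  rewrite -restrict_EFin; apply/integrable_restrict => //.
    exact: measurable_itv.
  by rewrite setTI; exact: continuous_segment_integrable.
have : \int[mu]_t ((fun=> (r / 2) ^+ 2) \_ I) t <= L2nsq (bump t0 r).
  apply: le_Rintegral => //.
    have := L2_compact_support (ccontinuous_bump t0 r) (@bump_far t0 r).
    by move=> /L2P[].
  move=> t _; rewrite patchE; case: ifPn => [|_]; last exact: nsq_ge0.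
  rewrite inE /I /= in_itv/= => /andP[t1 t2].
  rewrite nsq_real ler_sqr ?nnegrE ?(ltW r20)//; last by rewrite le_max lexx.
  rewrite le_max; apply/orP; right.
  have : `|t - t0| <= r / 2 by rewrite ler_norml; apply/andP; split; lra.
  by lra.
rewrite -Rintegral_mkcond; apply: lt_le_trans.
rewrite (@Rintegral_shift R r r0 (fun=> (r / 2) ^+ 2))// intT_cst//.
by rewrite mulr_gt0// exprn_gt0.
Qed.

(** Test the frame inequality on a bump of width at most T = 1/b around t0. At most
one point of t + T Z meets its support, so the periodization has at most one
term and the sum over n is |f|^2 times a partial sum of G_a. *)
Lemma frame_lower_bound (A : R) (t0 r s : R) :
  (forall f, L2 f -> (A%:E * cLnorm 2%:E f ^+ 2 <=
     \esum_(i in [set: int * int]) ((normc (L2inner f (WHsystem g a b i))) ^+ 2)%:E)%E) ->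
  0 < r ->
  (forall t N, `|t - t0| < r -> \sum_(n <- zbox N) nsq (g (t - n%:~R * a)) <= s) ->
  A * b <= s.
Proof.
move=> HA r0 Hs.
pose T := b^-1; have T0 : 0 < T by rewrite invr_gt0.
pose r' := Num.min r (T / 2).
have r'0 : 0 < r' by rewrite lt_min r0 divr_gt0.
have r'r : r' <= r by rewrite ge_min lexx.
have r'T : r' <= T / 2 by rewrite ge_min lexx orbT.
pose f := bump t0 r'; pose L := `|t0| + r'.
pose K := (Num.truncn (L / T)).+1.
have LK : L < K%:R * T by rewrite -ltr_pdivrMr// truncnS_gt.
have cf := ccontinuous_bump t0 r'.
have f0 := @bump_far t0 r'.
have Lf : L2 f := L2_compact_support cf f0.
have s0 : 0 <= s.
  by apply: le_trans (Hs t0 0%N _); rewrite ?subrr ?normr0// sumr_ge0// => n _; exact: nsq_ge0.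
have key N t : 0 <= t <= T ->
    \sum_(n <- zbox N) nsq (periodize T g f a K n t) <= s * \sum_(k < K.*2) nsq (f (tau T K k t)).
  move=> _.
  have [[k fk]|nok] := pselect (exists k : 'I_K.*2, f (tau T K k t) != 0); last first.
    rewrite big1 ?mulr_ge0 ?sumr_ge0// => [k _|n _]; first exact: nsq_ge0.
    rewrite /periodize big1 ?nsq0// => k _; have [->|fk] := eqVneq (f (tau T K k t)) 0.
      by rewrite mul0r.
    by case: nok; exists k.
  have ht k' : f (tau T K k' t) != 0 -> `|tau T K k' t - t0| < r'.
    by move=> fk'; rewrite ltNge; apply/negP => /bump_eq0 h; rewrite /f h eqxx in fk'.
  have one (k' : 'I_K.*2) : k' != k -> f (tau T K k' t) = 0.
    move=> kk; apply/eqP; apply: contraT => /ht h1; have h2 := ht _ fk.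
    have : `|tau T K k' t - tau T K k t| < T.
      have := ler_normB (tau T K k' t - t0) (tau T K k t - t0).
      by rewrite opprB addrA subrK; lra.
    have -> : tau T K k' t - tau T K k t = (k'%:Z - k%:Z)%:~R * T.
      by rewrite /tau intrB -!pmulrn; ring.
    rewrite normrM (gtr0_norm T0) gtr_pMl// -intr_norm -[1]/(1%:~R) ltr_int.
    by move=> h; case/eqP: kk; apply: val_inj => /=; move: h; clear; lia.
  rewrite (bigD1 k)//= [X in _ + X]big1 ?addr0 => [|k' /one ->]; last exact: nsq0.
  under eq_bigr => n _.
    rewrite /periodize (bigD1 k)//= big1 ?addr0 => [|k' /one ->]; last by rewrite mul0r.
    rewrite nsqM nsqJ.
    over.
  rewrite -mulr_sumr mulrC ler_wpM2r ?nsq_ge0//; apply: Hs.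
  exact: lt_le_trans (ht _ fk) r'r.
have up N : \sum_(n <- zbox N) \sum_(m <- zbox N) normc (L2inner f (WHsystem g a b (m, n))) ^+ 2 <=
    T * (s * L2nsq f).
  under eq_bigr do under eq_bigr do rewrite sqr_normc_nsq.
  apply: (test_upper T0 cg cf f0 LK); first by rewrite invrK.
  exact: key.
have := HA f Lf; rewrite cLnorm2_L2nsq// -EFinM => /le_trans /(_ (esum_le_box _ up)).
move=> /(_ (fun k => sqr_ge0 _)); rewrite lee_fin mulrA ler_pM2r ?L2nsq_bump_gt0//.
by rewrite /T ler_pdivlMl// mulrC.
Qed.

End Necessity.

(** * Stability of the lower bound and decay of the off-diagonal sums *)

Section Perturbation.
Variables (R : realType) (g : R -> R[i]).
Hypotheses (gW : wiener_amalgam g) (cg : ccontinuous g).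

(** If the partial sum of order N1 were below kap/4 at some t0, it would be so near
t0; adding the tail, all partial sums of G_a would be below kap/2 there, against
[frame_lower_bound], which would give kap <= kap/2 for kap = A b. *)
Lemma uniform_lower_bound (a b : R) : 0 < a -> 0 < b -> WHframe g a b ->
  exists (N : nat) (c : R), 0 < c /\ forall t, 0 <= t <= 2 * a ->
    c <= \sum_(n <- zbox N) nsq (g (t - n%:~R * a)).
Proof.
move=> a0 b0 [LWH [A [B [A0 B0 HAB]]]].
have gL2 : L2 g by case: gW.
have [al [Gam [al0 Gam0 Hsum Htail]]] := amalgam_sums gW cg.
pose q := (Num.truncn (al / a)).+1.
have qa : al <= q%:R * a by rewrite -ler_pdivrMr// ltW// truncnS_gt.
have q0 : (0 : R) < q%:R by rewrite ltr0n.
have gbd y : normc (g y) <= q%:R * Gam.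
  have := Hsum a q y [:: 0] a0 qa isT.
  by rewrite big_seq1 mulr0z mul0r subr0.
pose M := q%:R * Gam + 1.
have M0 : 0 < M by rewrite ltr_wpDl// mulr_ge0// ltW.
pose kap := A * b; have kap0 : 0 < kap by rewrite mulr_gt0.
(* Chosen so that the tail M q eta of the squared sums is kap/4. *)
pose eta := kap / (4 * M * q%:R).
have eta0 : 0 < eta by rewrite divr_gt0// !mulr_gt0.
have [X HX] := Htail eta eta0.
pose N1 := (Num.truncn ((`|X| + 2 * a + 1) / a)).+1.
have N1a : `|X| + 2 * a + 1 < N1%:R * a by rewrite -ltr_pdivrMr// truncnS_gt.
have tail t N : -1 <= t <= 2 * a + 1 -> \sum_(n <- zbox N) nsq (g (t - n%:~R * a)) <=
    \sum_(n <- zbox N1) nsq (g (t - n%:~R * a)) + kap / 4.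
  move=> /andP[t1 t2].
  apply: (@le_trans _ _ (\sum_(n <- zbox (maxn N N1)) nsq (g (t - n%:~R * a)))).
    by apply: le_zbox_sum; [exact: leq_maxl|move=> n; exact: nsq_ge0].
  rewrite (bigID (mem (zbox N1)))/=; apply: lerD.
    rewrite -big_filter; apply: le_sum_uniq_sub.
    - by rewrite filter_uniq// zbox_uniq.
    - exact: zbox_uniq.
    - by move=> n; rewrite mem_filter => /andP[].
    - by move=> n; exact: nsq_ge0.
  apply: (@le_trans _ _ (\sum_(n <- zbox (maxn N N1) | X <= `|t - n%:~R * a|)
     M * normc (g (t - n%:~R * a)))).
    rewrite big_mkcond [leRHS]big_mkcond; apply: ler_sum => n _.
    case: ifPn => [|_]; last first.
      by case: ifP => // _; rewrite mulr_ge0 ?normc_ge0// ltW.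
    rewrite mem_zbox -ltnNge => N1n.
    have -> : X <= `|t - n%:~R * a|.
      have h1 : N1%:R * a <= `|n%:~R * a|.
        rewrite normrM (gtr0_norm a0) ler_pM2r// -intr_norm pmulrn ler_int.
        by rewrite -abszE lez_nat ltnW.
      have h2 := ler_normB t (t - n%:~R * a); rewrite opprB addrC subrK in h2.
      have h3 : `|t| <= 2 * a + 1 by rewrite ler_norml; apply/andP; split; lra.
      by have := ler_norm X; lra.
    rewrite -sqr_normc_nsq expr2 ler_wpM2r ?normc_ge0//.
    by apply: (le_trans (gbd _)); rewrite lerDl.
  rewrite -mulr_sumr.
  apply: (@le_trans _ _ (M * (q%:R * eta))).
    by rewrite ler_pM2l//; apply: HX => //; exact: zbox_uniq.
  rewrite le_eqVlt; apply/orP; left; apply/eqP; rewrite /eta.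
  by field; rewrite !gt_eqF.
exists N1, (kap / 4); split; first by rewrite divr_gt0.
move=> t0 /andP[t00 t0a]; rewrite leNgt; apply/negP => Hlt.
have cS : continuous (fun t => \sum_(n <- zbox N1) nsq (g (t - n%:~R * a))).
  apply: continuous_sum => n; apply: continuous_nsq.
  exact: (ccontinuous_comp cg (@continuous_shift_by R (- (n%:~R * a)))).
have := @cvgr_lt _ _ _ (nbhs_filter t0) _ _ (cS t0) _ Hlt.
move=> /nbhs_ballP[r /= r0 Hr].
have r10 : 0 < Num.min r 1 by rewrite lt_min r0 ltr01.
(* A contradiction, as kap > 0. *)
suff : kap <= kap / 2 by lra.
apply: (@frame_lower_bound R g a b b0 cg A t0 (Num.min r 1)) => //.
  by move=> f Lf; case: (HAB f Lf).
move=> t N; rewrite lt_min => /andP[tr t1].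
move: t1; rewrite ltr_norml => /andP[t1 t2].
have := tail t N; rewrite (_ : -1 <= t <= 2 * a + 1); last by apply/andP; split; lra.
move=> /(_ isT) h; apply: (le_trans h).
have : \sum_(n <- zbox N1) nsq (g (t - n%:~R * a)) < kap / 4.
  by apply: Hr; rewrite /ball/= distrC.
by lra.
Qed.

(** On [0, 2a] each of the finitely many terms varies by at most e when a moves by
less than d. Any y is brought to [0, a'], inside [0, 2a], by subtracting k a' with
k the integer part of y/a', which shifts the box of indices by k. *)
Lemma perturbed_lower_bound (a b : R) : 0 < a -> 0 < b -> WHframe g a b ->
  exists d c : R, [/\ 0 < d, 0 < c, d <= a / 2 & forall a' L : R, `|a - a'| < d ->
    exists N : nat, forall y, `|y| <= L ->
      c <= \sum_(n <- zbox N) nsq (g (y - n%:~R * a'))].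
Proof.
move=> a0 b0 gf.
have [N [c [c0 Hc]]] := uniform_lower_bound a0 b0 gf.
pose X := 2 * a + N%:R * a.
(* The box has 2N + 1 elements, so the sum changes by at most c/2. *)
pose e := c / (2 * N.*2.+1%:R).
have e0 : 0 < e by rewrite divr_gt0// mulr_gt0// ltr0n.
have [d0 d00 Hd] := @continuous_segment_modulus R (fun t => nsq (g t)) (- X) X e
  (continuous_nsq cg) e0.
pose d := Num.min (a / 2) (d0 / N.+1%:R).
have dpos : 0 < d by rewrite lt_min !divr_gt0// ltr0n.
exists d, (c / 2); split => //; first by rewrite divr_gt0.
  by rewrite ge_min lexx.
move=> a' L aa'.
have da : d <= a / 2 by rewrite ge_min lexx.
have dN : d * N.+1%:R <= d0 by rewrite -ler_pdivlMr ?ltr0n// ge_min lexx orbT.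
have [a'1 a'2] : a / 2 < a' /\ a' < 2 * a.
  by move: aa'; rewrite ltr_norml => /andP[]; split; lra.
have a'0 : 0 < a' by lra.
have loc t : 0 <= t <= 2 * a -> c / 2 <= \sum_(n <- zbox N) nsq (g (t - n%:~R * a')).
  move=> /[dup] tt /andP[t1 t2]; have H := Hc t tt.
  suff : \sum_(n <- zbox N) nsq (g (t - n%:~R * a)) - \sum_(n <- zbox N) nsq (g (t - n%:~R * a')) <= c / 2.
    by lra.
  rewrite -sumrB; apply: (@le_trans _ _ (\sum_(n <- zbox N) e)); last first.
    rewrite zbox_sumE sumr_const card_ord -[e *+ _]mulr_natr /e.
    have : N.*2.+1%:R != 0 :> R by rewrite pnatr_eq0.
    move: (N.*2.+1%:R) => w w0; rewrite le_eqVlt; apply/orP; left; apply/eqP.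
    by field.
  rewrite big_seq [leRHS]big_seq; apply: ler_sum => n; rewrite mem_zbox => nN.
  have nNR : `|n%:~R| <= N%:R :> R by rewrite -intr_norm pmulrn ler_int -abszE lez_nat.
  apply: (le_trans (ler_norm _)); apply: ltW; apply: Hd.
    rewrite -ler_norml (le_trans (ler_normB _ _))// normrM (gtr0_norm a0) /X.
    apply: lerD; first by rewrite ger0_norm.
    exact: ler_wpM2r (ltW a0) _ _ nNR.
  have -> : t - n%:~R * a - (t - n%:~R * a') = n%:~R * (a' - a) by ring.
  rewrite normrM distrC; apply: (@le_lt_trans _ _ (N%:R * `|a - a'|)).
    by rewrite ler_wpM2r.
  apply: (@le_lt_trans _ _ (N%:R * d)); first by rewrite ler_wpM2l// ltW.
  apply: lt_le_trans dN; rewrite mulrC ltr_pM2l// ltr_nat//.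
pose N2 := (N + (Num.truncn (`|L| / a')).+2)%N.
exists N2 => y yL.
pose k := Num.floor (y / a').
have /andP[k1 k2] := floor_itv (y / a').
rewrite ler_pdivlMr// in k1; rewrite ltr_pdivrMr// intrD mulrDl mul1r in k2.
have := loc (y - k%:~R * a'); rewrite (_ : 0 <= _ <= _); last by apply/andP; split; rewrite /k; lra.
move=> /(_ isT) h; apply: (le_trans h).
have -> : \sum_(n <- zbox N) nsq (g (y - k%:~R * a' - n%:~R * a')) =
    \sum_(n <- [seq k + n | n <- zbox N]) nsq (g (y - n%:~R * a')).
  rewrite [RHS]big_map; apply: eq_bigr => n _; congr (nsq (g _)).
  by rewrite intrD mulrDl opprD addrA.
apply: le_sum_uniq_sub.
- by rewrite map_inj_uniq ?zbox_uniq//; exact: addrI.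
- exact: zbox_uniq.
- move=> _ /mapP[n nN ->]; move: nN; rewrite !mem_zbox => nN.
  have : (`|k| < (Num.truncn (`|L| / a')).+2)%N.
    have : `|k%:~R| < (Num.truncn (`|L| / a')).+2%:R :> R.
      have h3 : `|y / a'| < (Num.truncn (`|L| / a')).+1%:R.
        apply: le_lt_trans (truncnS_gt _).
        rewrite normrM normfV (gtr0_norm a'0) ler_pM2r ?invr_gt0//.
        by rewrite (le_trans yL)// ler_norm.
      have /andP[f1 f2] := floor_itv (y / a'); rewrite intrD in f2.
      rewrite -[(Num.truncn _).+2%:R]natr1.
      move: h3; rewrite !ltr_norml /k => /andP[h3 h4].
      by apply/andP; split; lra.
    by rewrite -intr_norm pmulrn ltr_int -abszE ltz_nat.
  by rewrite /N2; move: (Num.truncn _) nN; clear; move=> w; lia.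
- by move=> n; exact: nsq_ge0.
Qed.

(** If l <> 0 and T >= 2X, then z or z - lT has modulus at least X. So the products
are dominated by two families in which one factor is restricted to the far
region, and [amalgam_sums] makes that factor small and bounds the other. Steps
in n have length at least a/2 and steps in l length at least T. *)
Lemma offdiagonal_sums (a : R) : 0 < a ->
  exists D T0 : R, [/\ 0 < D, 0 < T0,
    (forall (a' T y : R) (J I : seq int), a / 2 <= a' -> T0 <= T -> uniq J -> uniq I ->
      \sum_(n <- J) \sum_(l <- I) normc (g (y - n%:~R * a')) *
         normc (g (y - n%:~R * a' - l%:~R * T)) <= D) &
    forall e, 0 < e -> exists T1 : R, T0 <= T1 /\
     forall (a' T y : R) (J I : seq int), a / 2 <= a' -> T1 <= T -> uniq J -> uniq I ->
      0 \notin I ->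
      \sum_(n <- J) \sum_(l <- I) normc (g (y - n%:~R * a')) *
         normc (g (y - n%:~R * a' - l%:~R * T)) <= e].
Proof.
move=> a0.
have [al [Gam [al0 Gam0 Hsum Htail]]] := amalgam_sums gW cg.
have a20 : 0 < a / 2 by rewrite divr_gt0.
pose q := (Num.truncn (al / (a / 2))).+1.
have q0 : (0 : R) < q%:R by rewrite ltr0n.
have qa a' : a / 2 <= a' -> al <= q%:R * a'.
  move=> h; apply: (@le_trans _ _ (q%:R * (a / 2))); last by rewrite ler_pM2l.
  by rewrite -ler_pdivrMr// ltW// truncnS_gt.
have sumT T y I : al <= T -> uniq I -> \sum_(l <- I) normc (g (y - l%:~R * T)) <= Gam.
  move=> alT uI; have := Hsum T 1%N y I (lt_le_trans al0 alT).
  by rewrite !mul1r; apply.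
exists (q%:R * Gam * Gam + 1), al; split => //.
- by rewrite ltr_wpDl// !mulr_ge0// ltW.
- move=> a' T y J I aa' alT uJ uI; have a'0 := lt_le_trans a20 aa'.
  under eq_bigr do rewrite -mulr_sumr.
  apply: (@le_trans _ _ (\sum_(n <- J) normc (g (y - n%:~R * a')) * Gam)).
    by apply: ler_sum => n _; rewrite ler_wpM2l ?normc_ge0//; exact: sumT.
  rewrite -mulr_suml (@le_trans _ _ (q%:R * Gam * Gam)) ?lerDl// ler_wpM2r//.
  by apply: Hsum => //; exact: qa.
move=> e e0.
pose eta := e / (2 * q%:R * (Gam + 1)).
have G1 : 0 < Gam + 1 by rewrite ltr_wpDl.
have eta0 : 0 < eta by rewrite divr_gt0// !mulr_gt0.
have [X HX] := Htail eta eta0.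
exists (Num.max al (2 * `|X|)); split; first by rewrite le_max lexx.
move=> a' T y J I aa'; rewrite ge_max => /andP[alT XT] uJ uI I0.
have a'0 := lt_le_trans a20 aa'; have T0 := lt_le_trans al0 alT.
pose far (t : R) := if X <= `|t| then normc (g t) else 0.
have far0 t : 0 <= far t by rewrite /far; case: ifP => // _; exact: normc_ge0.
have pair z l : l != 0 -> normc (g z) * normc (g (z - l%:~R * T)) <=
    far z * normc (g (z - l%:~R * T)) + normc (g z) * far (z - l%:~R * T).
  move=> l0.
  have [Xz|Xz] := leP X `|z|.
    by rewrite {1}/far Xz lerDl mulr_ge0 ?normc_ge0.
  have -> : far z = 0 by rewrite /far leNgt Xz.
  rewrite mul0r add0r /far ifT//.
  have lT : T <= `|l%:~R * T|.
    rewrite normrM (gtr0_norm T0) ler_pMl// -intr_norm -[1]/(1%:~R) ler_int.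
    by rewrite -gtz0_ge1 normr_gt0.
  have := ler_normB z (z - l%:~R * T); rewrite opprB addrC subrK.
  by have := ler_norm X; lra.
apply: (@le_trans _ _ (\sum_(n <- J) (far (y - n%:~R * a') * Gam + normc (g (y - n%:~R * a')) * eta))).
  apply: ler_sum => n _; set z := y - _.
  apply: (@le_trans _ _ (\sum_(l <- I) (far z * normc (g (z - l%:~R * T)) +
      normc (g z) * far (z - l%:~R * T)))).
    rewrite big_seq [leRHS]big_seq; apply: ler_sum => l lI; apply: pair.
    by apply: contraNneq I0 => <-.
  rewrite big_split/= -!mulr_sumr; apply: lerD.
    by apply: ler_wpM2l => //; exact: sumT.
  apply: ler_wpM2l; first exact: normc_ge0.
  rewrite -big_mkcond/=; have := HX T 1%N z I T0; rewrite !mul1r; exact.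
rewrite big_split/= -!mulr_suml.
apply: (@le_trans _ _ (q%:R * eta * Gam + q%:R * Gam * eta)).
  apply: lerD; apply: ler_wpM2r => //; last 2 first.
  - exact: ltW.
  - by apply: Hsum => //; exact: qa.
  by rewrite -big_mkcond/=; apply: HX => //; exact: qa.
have -> : q%:R * eta * Gam + q%:R * Gam * eta = e * (Gam / (Gam + 1)).
  by rewrite /eta; field; rewrite !gt_eqF.
by rewrite ler_piMr ?(ltW e0)// ler_pdivrMr// mul1r lerDl.
Qed.

End Perturbation.

(** * The theorem *)

Section PointwiseBounds.
Variables (R : realType) (g f : R -> R[i]) (a T : R) (K : nat).

(** For a fixed row i, the columns j <> i correspond to the nonzero differences
l = i - j, since the point of column j is the point of row i minus (i - j) T. *)
Lemma offdiagonal_reindex (J : seq int) (i : 'I_K.*2) (t : R) :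
  exists I : seq int, [/\ uniq I, 0 \notin I &
  \sum_(j < K.*2 | j != i) \sum_(n <- J) normc (conjc (g (tau T K i t - n%:~R * a))) *
      normc (conjc (g (tau T K j t - n%:~R * a))) =
  \sum_(n <- J) \sum_(l <- I) normc (g (tau T K i t - n%:~R * a)) *
      normc (g (tau T K i t - n%:~R * a - l%:~R * T))].
Proof.
exists [seq i%:Z - j%:Z | j : 'I_K.*2 <- [seq j <- index_enum 'I_K.*2 | j != i]]; split.
- rewrite map_inj_in_uniq ?filter_uniq ?index_enum_uniq// => j k _ _ /addrI /oppr_inj [].
  exact: val_inj.
- apply/mapP => -[j]; rewrite mem_filter => /andP[ji _] /esym/eqP.
  by rewrite subr_eq0 eqz_nat => /eqP /val_inj ij; rewrite ij eqxx in ji.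
rewrite exchange_big; apply: eq_bigr => n _; rewrite big_map big_filter.
apply: eq_bigr => j _; rewrite !normc_conj; congr (_ * normc (g _)).
by rewrite /tau intrB -!pmulrn; ring.
Qed.

(** [schur_near] for the matrix with entries conj(g(t + (i - K) T - n a)). *)
Lemma periodize_schur (J : seq int) (t e : R) :
  (forall (i : 'I_K.*2) (I : seq int), uniq I -> 0 \notin I ->
    \sum_(n <- J) \sum_(l <- I) normc (g (tau T K i t - n%:~R * a)) *
      normc (g (tau T K i t - n%:~R * a - l%:~R * T)) <= e) ->
  `|\sum_(n <- J) nsq (periodize T g f a K n t) -
    \sum_(i < K.*2) nsq (f (tau T K i t)) *
      \sum_(n <- J) nsq (g (tau T K i t - n%:~R * a))| <=
    e * \sum_(i < K.*2) nsq (f (tau T K i t)).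
Proof.
move=> He.
have -> : \sum_(i < K.*2) nsq (f (tau T K i t)) *
      \sum_(n <- J) nsq (g (tau T K i t - n%:~R * a)) =
    \sum_(i < K.*2) nsq (f (tau T K i t)) *
      \sum_(n <- J) nsq (conjc (g (tau T K i t - n%:~R * a))).
  apply: eq_bigr => i _; congr (_ * _).
  by apply: eq_bigr => n _; rewrite nsqJ.
apply: (@schur_near R 'I_K.*2 int J (fun i => f (tau T K i t))
  (fun n i => conjc (g (tau T K i t - n%:~R * a))) e) => i.
by have [I [uI I0 ->]] := offdiagonal_reindex J i t; exact: He.
Qed.

End PointwiseBounds.

Theorem corollary3p6 (R : realType) (a b : R) (g : R -> R[i])
    (a_gt0 : 0 < a) (b_gt0 : 0 < b)
    (gW : wiener_amalgam g)
    (g_cont : continuous (g : R -> R[i]^o))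
    (g_frame : WHframe g a b) :
  exists delta b0 : R, [/\ 0 < delta, 0 < b0 &
    forall a' b' : R, 0 < a' -> `|a - a'| < delta -> 0 < b' -> b' < b0 ->
      WHframe g a' b'].
Proof.
have cg := continuous_ccontinuous g_cont.
have gL2 : L2 g by case: gW.
have [d [c [d0 c0 da Hc]]] := perturbed_lower_bound gW cg a_gt0 b_gt0 g_frame.
have [D [T0 [D0 T00 HD He]]] := offdiagonal_sums gW cg a_gt0.
have c20 : 0 < c / 2 by rewrite divr_gt0.
have [T1 [T01 HT1]] := He _ c20.
have T10 : 0 < T1 := lt_le_trans T00 T01.
(* Small b' means a long period T >= T1, where the off-diagonal row sums are at
most half the lower bound c of the diagonal entries. *)
exists d, T1^-1; split; [exact: d0 | by rewrite invr_gt0 | ].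
move=> a' b' a'0 aa' b'0 b'T.
pose T := b'^-1; have Tpos : 0 < T by rewrite invr_gt0.
have bT : b' = T^-1 by rewrite invrK.
have T1T : T1 <= T by rewrite -[T1]invrK lef_pV2 ?posrE ?invr_gt0// ltW.
have T0T : T0 <= T := le_trans T01 T1T.
have aa2 : a / 2 <= a' by move: aa'; rewrite ltr_norml => /andP[]; lra.
apply: (@frame_from_test R _ _ (T * (c / 2)) (T * (2 * D))).
- by move=> k; exact: L2_WHsystem.
- by rewrite mulr_gt0.
- by rewrite !mulr_gt0.
move=> f L cf f0.
pose K := (Num.truncn (`|L| / T)).+1.
have LK : L < K%:R * T.
  by rewrite (le_lt_trans (ler_norm L))// -ltr_pdivrMr// truncnS_gt.
split=> [N|e e0].
  rewrite -mulrA /boxsum; apply: (test_upper Tpos cg cf f0 LK (a := a') (J := zbox N) (D := 2 * D) N bT) => t tT.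
  have := @periodize_schur R g f a' T K (zbox N) t D.
  move=> /(_ (fun i I uI _ => HD _ _ _ _ _ aa2 T0T (zbox_uniq N) uI)).
  move=> /(le_trans (ler_norm _)); rewrite lerBlDl => /le_trans; apply.
  rewrite -mulrA mulr2n mulrDl mul1r lerD2r mulr_sumr; apply: ler_sum => i _.
  rewrite mulrC ler_wpM2r ?nsq_ge0//.
  apply: le_trans (HD a' T (tau T K i t) (zbox N) [:: 0] aa2 T0T (zbox_uniq N) isT).
  apply: ler_sum => n _.
  by rewrite big_seq1 mulr0z mul0r subr0 -sqr_normc_nsq expr2.
have [N HN] := Hc a' L aa'.
suff [M HM] : exists M, T * (c / 2 * L2nsq f) - e <= boxsum (WHsystem g a' b') (zbox N) M f.
  by exists (zbox N), M; rewrite zbox_uniq -mulrA.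
rewrite /boxsum; apply: (test_lower Tpos cg cf f0 LK (a := a') (J := zbox N) (c := c / 2) bT e0) => t tT.
have := @periodize_schur R g f a' T K (zbox N) t (c / 2).
move=> /(_ (fun i I uI I0 => HT1 _ _ _ _ _ aa2 T1T (zbox_uniq N) uI I0)).
rewrite ler_norml => /andP[h _].
have : c * \sum_(i < K.*2) nsq (f (tau T K i t)) <=
    \sum_(i < K.*2) nsq (f (tau T K i t)) *
      \sum_(n <- zbox N) nsq (g (tau T K i t - n%:~R * a')).
  rewrite mulr_sumr; apply: ler_sum => i _; rewrite mulrC.
  have [->|fi] := eqVneq (f (tau T K i t)) 0; first by rewrite nsq0 !mul0r.
  rewrite ler_wpM2l ?nsq_ge0//; apply: HN; rewrite leNgt.
  by apply/negP => /f0 fi0; rewrite fi0 eqxx in fi.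
by lra.
Qed.
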